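(* Let $n\ge 3$ be an odd integer, and let $\mathbb{G}_{n,\lfloor n/2\rfloor}$ be the set of all connected simple graphs on $n$ vertices with domination number $\lfloor n/2\rfloor$. For every $G\in \mathbb{G}_{n,\lfloor n/2\rfloor}$ we have $\rho(G)\ge \rho\big(T^{\frac{n+3}{2}}_{\lceil\frac{n-3}{4}\rceil,\lfloor\frac{n-3}{4}\rfloor}\big)$, with equality if and only if $G\cong T^{\frac{n+3}{2}}_{\lceil\frac{n-3}{4}\rceil,\lfloor\frac{n-3}{4}\rfloor}$.
   Context: All graphs are finite, simple and undirected. $\rho(G)$ denotes the spectral radius (largest eigenvalue) of the adjacency matrix of $G$. A set $D\subseteq V(G)$ is dominating if every vertex outside $D$ has a neighbor in $D$; the domination number $\gamma(G)$ is the minimum size of a dominating set. For a path $P_{d+1}=u_1u_2\cdots u_{d+1}$ and integers $0\le j\le i\le d+1$, $T^{d+1}_{i,j}$ denotes the tree on $i+j+d+1$ vertices obtained from $P_{d+1}$ by attaching one new pendant vertex to each of the first $i$ vertices $u_1,\dots,u_i$ and to each of the last $j$ vertices $u_{d+2-j},\dots,u_{d+1}$. *)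

(* Defs.v *)
From HB Require Import structures.
From mathcomp Require Import all_boot all_order all_algebra.
From mathcomp Require Import all_classical reals.
From mathcomp Require Import spectral complex polyrcf.

Set Implicit Arguments.
Unset Strict Implicit.
Unset Printing Implicit Defensive.

Import Order.TTheory GRing.Theory Num.Theory.

Record sgraph := SGraph {
  vertex :> finType;
  adj : rel vertex;
  adj_sym : symmetric adj;
  adj_irr : irreflexive adj
}.

Definition connected (G : sgraph) : Prop :=
  (0 < #|G|)%N /\ forall x y : G, connect (@adj G) x y.

Definition graph_iso (G H : sgraph) : Prop :=
  exists2 f : G -> H, bijective f & forall x y : G, adj (f x) (f y) = adj x y.

Definition dominating (G : sgraph) (D : {set G}) : bool :=
  [forall v, (v \notin D) ==> [exists u in D, adj u v]].

Lemma dominating_setT (G : sgraph) : dominating [set: G].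
Proof. by apply/forallP => v; rewrite inE. Qed.

Definition domination_number (G : sgraph) : nat :=
  #|[arg min_(D < [set: G] | dominating D) #|D|]|.

Lemma domination_numberP (G : sgraph) :
  (exists2 D : {set G}, dominating D & #|D| = domination_number G) /\
  (forall D : {set G}, dominating D -> (domination_number G <= #|D|)%N).
Proof.
rewrite /domination_number; case: arg_minnP; first exact: dominating_setT.
by move=> D hD m; split=> //; exists D.
Qed.

Definition adjmx (R : realType) (G : sgraph) : 'M[R]_#|G| :=
  \matrix_(i, j) ((adj (enum_val i) (enum_val j))%:R)%R.

(* For a graph with at least one vertex this supremum is attained, hence is
   the largest eigenvalue: see [spectral_radius_max]. *)
Definition spectral_radius (R : realType) (G : sgraph) : R :=
  sup [set a : R | eigenvalue (adjmx R G) a]%classic.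

Local Open Scope ring_scope.

Lemma adjmx_eigenvalue_ex (R : realType) (G : sgraph) : (0 < #|G|)%N ->
  exists a, eigenvalue (adjmx R G) a.
Proof.
move=> G0; set A := adjmx R G.
pose B := map_mx (@real_complex R) A.
have hB : B \is hermsymmx.
  apply: realsym_hermsym.
    by apply/is_hermitianmxP; rewrite expr0 scale1r; apply/matrixP => i j; rewrite !mxE adj_sym.
  by apply/mxOverP => i j; rewrite mxE; apply/complex_realP; eexists.
have /mxOverP hr := hermitian_spectral_diag_real hB.
have /hermitian_normalmx /orthomx_spectralP eB := hB.
pose i0 : 'I_#|G| := Ordinal G0.
have /complex_realP [k hk] := hr 0 i0.
exists k; rewrite -(eigenvalue_map (real_complex R)).
have {}hk : spectral_diag B 0 i0 = real_complex R k := hk.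
rewrite -[X in eigenvalue _ X]hk; apply/eigenvalueP; exists (row i0 (spectralmx B)).
  rewrite -row_mul [X in _ *m X]eB !mulmxA mulmxV ?spectral_unit // mul1mx.
  by apply/rowP => j; rewrite mul_diag_mx !mxE.
apply/eqP => h0; have := mulmxV (spectral_unit B).
move/(congr1 (row i0)); rewrite row_mul h0 mul0mx => /rowP /(_ i0).
by rewrite !mxE eqxx => /esym/eqP; rewrite oner_eq0.
Qed.

Lemma spectral_radius_max (R : realType) (G : sgraph) : (0 < #|G|)%N ->
  eigenvalue (adjmx R G) (spectral_radius R G) /\
  (forall a, eigenvalue (adjmx R G) a -> a <= spectral_radius R G).
Proof.
move=> G0; have [a0 ha0] := adjmx_eigenvalue_ex R G0.
set A := adjmx R G in ha0 *; pose s := rootsR (char_poly A).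
have sP a : eigenvalue A a = (a \in s).
  by rewrite eigenvalue_root_char -(roots_on_rootsR (monic_neq0 (char_poly_monic A))) /=.
have a0s : a0 \in s by rewrite -sP.
have s0 : (0 < size s)%N by case: (s) a0s.
have [m ms hm] : exists2 m, m \in s & forall a, a \in s -> a <= m.
  case: (@Order.TotalTheory.arg_maxP _ _ 'I_(size s) (Ordinal s0) xpredT (fun i => s`_i)) => // i _ hi.
  exists s`_i; first exact: mem_nth (ltn_ord i).
  move=> a ain; have la : (index a s < size s)%N by rewrite index_mem.
  by have := hi (Ordinal la) isT; rewrite /= nth_index.
suff -> : spectral_radius R G = m by rewrite sP; split=> // a; rewrite sP; exact: hm.
apply/le_anti/andP; split.
  apply: ge_sup; first by exists a0.
  by move=> a /=; rewrite sP; exact: hm.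
apply: ub_le_sup; last by rewrite /= -/A sP.
by exists m => a /=; rewrite -/A sP; exact: hm.
Qed.

Local Close Scope ring_scope.

Definition ceildivn (m d : nat) : nat := ((m + d.-1) %/ d)%N.

Section PathWithPendants.
Variables m i j : nat.

(* [inl k] is the path vertex u_(k+1); [inr (inl a)] is the pendant vertex
   attached to u_(a+1); [inr (inr b)] is the pendant vertex attached to
   u_(m+1-j+b), whose 0-based index k satisfies k = m - j + b. *)
Definition pend_vertex : finType := ('I_m + ('I_i + 'I_j))%type.

Definition pend_arc (x y : pend_vertex) : bool :=
  match x, y with
  | inl k, inl l => (k.+1 == l :> nat)
  | inl k, inr (inl a) => (k == a :> nat)
  | inl k, inr (inr b) => (k + j == m + b)%N
  | _, _ => false
  end.

Definition pend_adj : rel pend_vertex :=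
  [rel x y | pend_arc x y || pend_arc y x].

Lemma pend_adj_sym : symmetric pend_adj.
Proof. by move=> x y; exact: orbC. Qed.

Lemma pend_adj_irr : irreflexive pend_adj.
Proof. by case=> [k|[a|b]] //; apply/norP; rewrite /= eqn_leq ltnn. Qed.

(* The tree T^m_(i,j), meaningful for j <= i <= m: when i or j exceeds m some
   pendant vertices are left isolated. *)
Definition Ttree : sgraph := SGraph pend_adj_sym pend_adj_irr.

End PathWithPendants.

(* Main.v *)
(* Write n = 2k+1. A spanning tree of G has domination number k as well, and
   then has one of two shapes. Either it is a "star": a center x, to whose
   component coronas (trees in which each vertex carries one private leaf) are
   attached through their non-leaf vertices; or it is a path u - v - w with
   two such stars centered at u and w. Let lam be the spectral radius of T.
   If rho(G) <= lam, the Perron vector y of G satisfies A y <= lam y also on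
   the spanning tree. Eliminating the leaves turns lam into
   mu = lam - 1/lam on the corona vertices, and a star on 2a + 1 vertices
   satisfies (sum of y over the neighbors of its center) >= p_a y(center),
   where p_a = U_(a-1)(mu/2) / U_a(mu/2), with equality only for a path with
   pendant vertices. Since lam is critical for the balanced lengths (i, j), any
   other distribution of the corona vertices contradicts A y <= lam y. Hence
   G contains a spanning copy of T, and strict monotonicity of the spectral
   radius gives G = T. *)
Require Import Defs.
From mathcomp Require Import all_boot all_order all_algebra.
From mathcomp Require Import all_classical reals.
From mathcomp Require Import spectral complex.
From mathcomp Require Import zify ring lra.

Set Implicit Arguments.
Unset Strict Implicit.
Unset Printing Implicit Defensive.

Import Order.TTheory GRing.Theory Num.Theory.

(** * Spanning trees and the structure forced by the domination number *)

Ltac perm_count p :=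
  apply/permP=> P; move/permP: p => /(_ P);
  rewrite /= ?count_cat /= ?count_cat /= ?count_cat /= ?count_cat; lia.

Ltac perm_count2 p q :=
  apply/permP=> P; move/permP: p => /(_ P); move/permP: q => /(_ P);
  rewrite /= ?count_cat /= ?count_cat /= ?count_cat /= ?count_cat; lia.

Section RootedTrees.
Variable G : sgraph.
Implicit Types (x y r t u v w l : G) (S A D : seq G).

(** Each step adds one edge [x t], so an induction over a tree only ever joins two rooted trees.
    Distinctness of the vertices is not built in; it comes from [perm_eq S (enum G)]. *)
Inductive rtree : G -> seq G -> Prop :=
| rtree1 x : rtree x [:: x]
| rtreeJ x S t S' : rtree x S -> rtree t S' -> adj x t -> rtree x (S ++ S').

(* [S] lists the 2a + 1 vertices of a tree made of the center [x] and of coronas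
   joined to it, and [A] those that may carry further coronas: [x] and the
   corona vertices other than the private leaves. In [starJ] the subtree of the
   child [t] is a star which the private leaf [l] turns into a corona. *)
Inductive star : G -> nat -> seq G -> seq G -> Prop :=
| star1 x : star x 0 [:: x] [:: x]
| starJ x a S A t b S' A' l T : star x a S A -> star t b S' A' ->
    adj x t -> adj t l -> perm_eq T (l :: S ++ S') ->
    star x (a + b).+1 T (A ++ A').

(* Two stars whose centers are joined through a vertex [v], on 2k + 1 vertices. *)
Definition bistar (k : nat) S A : Prop :=
  exists v u w, exists a S1 A1, exists b S2 A2,
    [/\ star u a S1 A1, star w b S2 A2, adj v u /\ adj v w,
        perm_eq S (v :: S1 ++ S2) & A = A1 ++ A2 /\ k = (a + b).+1].

Definition core S A : Prop := exists k, (exists x, star x k S A) \/ bistar k S A.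

Lemma rtree_mem x S : rtree x S -> x \in S.
Proof. by elim=> [y|y S1 t S' _ IH _ _ _]; rewrite ?mem_head // mem_cat IH. Qed.

Lemma rtree_grow x S : rtree x S -> forall a b, a \in S -> adj a b ->
  exists2 S', rtree x S' & perm_eq S' (b :: S).
Proof.
elim=> [y|y S1 t S2 h1 IH1 h2 IH2 yt] a b.
  rewrite inE => /eqP-> ab; exists ([:: y] ++ [:: b]); last by rewrite perm_catC.
  by apply: rtreeJ ab; exact: rtree1.
rewrite mem_cat => /orP[aS|aS] ab.
  have [S' h p] := IH1 _ _ aS ab; exists (S' ++ S2); first exact: rtreeJ yt.
  by rewrite -cat_cons perm_cat2r.
have [S' h p] := IH2 _ _ aS ab; exists (S1 ++ S'); first exact: rtreeJ yt.
by rewrite perm_sym -cat1s perm_catCA /= perm_cat2l perm_sym.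
Qed.

(** If a tree misses a vertex, the path from the root to that vertex has an edge leaving the tree,
    and [rtree_grow] adds the end of that edge. *)
Lemma rtree_exists x : (forall y, connect (@adj G) x y) ->
  exists2 S, rtree x S & perm_eq S (enum G).
Proof.
move=> conn.
suff [S [h uS cS]] : exists S, [/\ rtree x S, uniq S & forall v, v \in S].
  exists S => //; apply: uniq_perm; rewrite ?enum_uniq // => v.
  by rewrite mem_enum cS.
have: exists S, [/\ rtree x S, uniq S & #|G| - size S <= #|G|].
  by exists [:: x]; split=> //; [exact: rtree1 | exact: leq_subr].
move: {2}#|G| => m; elim: m => [|m IH] [S [h uS szS]].
  have sS : size S = #|G|.
    by have := max_card (mem S); rewrite (card_uniqP uS); move: szS; lia.
  exists S; split=> // v; have/subset_cardP: #|S| = #|G| by rewrite (card_uniqP uS).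
  by move/(_ (subset_predT _)) ->.
case: (pickP [pred v | v \notin S]) => [v /= vS|all_in]; last first.
  by exists S; split=> // v; have /= /negbFE := all_in v.
apply: IH; suff [a [b [aS bS ab]]] : exists a b, [/\ a \in S, b \notin S & adj a b].
  have [S' h' p] := rtree_grow h aS ab; exists S'; split=> //.
    by rewrite (perm_uniq p) /= bS.
  by rewrite (perm_size p) leq_subLR addSnnS -leq_subLR.
have [p pth lst] := connectP (conn v).
have := rtree_mem h; elim: p {h conn} x pth lst => [|z p IHp] y /=.
  by move=> _ <- vS'; rewrite vS' in vS.
move=> /andP[yz pth] lst yS; case: (boolP (z \in S)) => zS; first exact: IHp pth lst zS.
by exists y, z.
Qed.

Lemma star_center x a S A : star x a S A -> x \in A.
Proof. by elim=> [y|y a' S1 A1 t b S2 A2 l T _ IH *]; rewrite ?mem_head // mem_cat IH. Qed.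

Lemma star_size x a S A : star x a S A -> size S = a.*2.+1.
Proof.
by elim=> [//|y a' S1 A1 t b S2 A2 l T _ IH1 _ IH2 _ _ /perm_size->] /=; rewrite size_cat; lia.
Qed.

Lemma star_perm x a S A T : star x a S A -> perm_eq T S -> star x a T A.
Proof.
case=> [y|y a' S1 A1 t b S2 A2 l T' h1 h2 yt tl p] q.
  by rewrite (perm_small_eq _ q) //; exact: star1.
by apply: (starJ h1 h2 yt tl); exact: perm_trans q p.
Qed.

(** The new branch goes into the subtree that contains [v], so only the grouping of the sizes
    changes. *)
Lemma star_attach x a S A : star x a S A -> forall v t b S' A' l,
  v \in A -> star t b S' A' -> adj v t -> adj t l ->
  exists2 A'', star x (a + b).+1 (l :: S ++ S') A'' & {subset A ++ A' <= A''}.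
Proof.
elim=> [y|y a' S1 A1 z c S2 A2 m T h1 IH1 h2 IH2 yz zm p] v t b S' A' l vA ht vt tl.
  by move: vA vt; rewrite inE => /eqP-> vt; exists ([:: y] ++ A') => //; apply: starJ ht vt tl _ => //; exact: star1.
move: vA; rewrite mem_cat => /orP[vA|vA].
  have [A'' h sub] := IH1 _ _ _ _ _ _ vA ht vt tl; exists (A'' ++ A2).
    rewrite (_ : (a' + c).+1 + b = (a' + b).+1 + c); last by lia.
    apply: starJ h h2 yz zm _; perm_count p.
  by move=> u; move: (sub u); rewrite !mem_cat; do 4?case: (u \in _) => //=; move/(_ isT).
have [A'' h sub] := IH2 _ _ _ _ _ _ vA ht vt tl; exists (A1 ++ A'').
  rewrite (_ : (a' + c).+1 + b = a' + (c + b).+1); last by lia.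
  apply: starJ h1 h yz zm _; perm_count p.
by move=> u; move: (sub u); rewrite !mem_cat; do 4?case: (u \in _) => //=; move/(_ isT).
Qed.

Lemma core_perm S A T : core S A -> perm_eq T S -> core T A.
Proof.
move=> [k [[x h]|[v [u [w [a [S1 [A1 [b [S2 [A2 [h1 h2 h3 p h4]]]]]]]]]]]] q; exists k.
  by left; exists x; exact: star_perm h q.
right; exists v, u, w, a, S1, A1, b, S2, A2; split=> //; exact: perm_trans q p.
Qed.

Lemma core_attach S A v t b S' A' l : core S A -> v \in A ->
  star t b S' A' -> adj v t -> adj t l ->
  exists2 A'', core (l :: S ++ S') A'' & {subset A ++ A' <= A''}.
Proof.
move=> [k [[x h]|[c [u [w [a [S1 [A1 [d [S2 [A2 [h1 h2 h3 p [-> _]]]]]]]]]]]]] vA ht vt tl.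
  have [A'' h' sub] := star_attach h vA ht vt tl; exists A'' => //.
  by exists (k + b).+1; left; exists x.
move: vA; rewrite mem_cat => /orP[vA|vA].
  have [A'' h' sub] := star_attach h1 vA ht vt tl; exists (A'' ++ A2).
    exists ((a + b).+1 + d).+1; right; exists c, u, w, (a + b).+1, (l :: S1 ++ S'), A'', d, S2, A2.
    split=> //; perm_count p.
  by move=> z; move: (sub z); rewrite !mem_cat; do 4?case: (z \in _) => //=; move/(_ isT).
have [A'' h' sub] := star_attach h2 vA ht vt tl; exists (A1 ++ A'').
  exists (a + (d + b).+1).+1; right; exists c, u, w, a, S1, A1, (d + b).+1, (l :: S2 ++ S'), A''.
  split=> //; perm_count p.
by move=> z; move: (sub z); rewrite !mem_cat; do 4?case: (z \in _) => //=; move/(_ isT).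
Qed.

End RootedTrees.

(** * Partial dominating sets of rooted trees and their deficits *)

Section Domination.
Variable G : sgraph.
Implicit Types (x y r t u v w l : G) (S A D : seq G).

Definition dominated D v := has (fun u => (u == v) || adj u v) D.

(* Whether the root of a rooted tree is allowed to be undominated, is dominated,
   or belongs to the partial dominating set [D]. The deficit of [D] is
   |S| - 2 |D|; each clause of [deficit_shape] says what the tree is when the
   deficit is so small that the whole tree may still end up with deficit 1. *)
Variant root_status := Undominated | Dominated | Selected.

Definition partial_dominating (s : root_status) r S D : Prop :=
  match s with
  | Undominated => forall v, v \in S -> v != r -> dominated D v
  | Dominated => forall v, v \in S -> dominated D v
  | Selected => r \in D /\ forall v, v \in S -> dominated D v
  end.

Definition deficit_shape (s : root_status) (d : nat) r S : Prop :=
  match s, d with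
  | Undominated, 0 => False
  | Undominated, 1 => S = [:: r]
  | Undominated, 2 =>
      exists y a S' A, [/\ star y a S' A, adj r y & perm_eq S (r :: S')]
  | Undominated, 3 => exists A, core S A
  | Dominated, 0 => False
  | Dominated, 1 => exists a A, star r a S A
  | Dominated, 2 => forall l, adj r l -> exists2 A, core (l :: S) A & r \in A
  | Selected, 0 =>
      exists l a S' A, [/\ star r a S' A, adj r l & perm_eq S (l :: S')]
  | Selected, 1 => exists2 A, core S A & r \in A
  | _, _ => True
  end.

Lemma dominated_catl D1 D2 v : dominated D1 v -> dominated (D1 ++ D2) v.
Proof. by rewrite /dominated has_cat => ->. Qed.

Lemma dominated_catr D1 D2 v : dominated D2 v -> dominated (D1 ++ D2) v.
Proof. by rewrite /dominated has_cat => ->; rewrite orbT. Qed.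

Lemma dominated_adj D u v : u \in D -> adj u v -> dominated D v.
Proof. by move=> uD uv; apply/hasP; exists u => //; rewrite uv orbT. Qed.

Lemma star_core x a S A : star x a S A -> core S A.
Proof. by exists a; left; exists x. Qed.

Lemma core_bistar v u w a S1 A1 b S2 A2 S : star u a S1 A1 -> star w b S2 A2 ->
  adj v u -> adj v w -> perm_eq S (v :: S1 ++ S2) -> core S (A1 ++ A2).
Proof.
move=> h1 h2 vu vw p; exists (a + b).+1; right.
by exists v, u, w, a, S1, A1, b, S2, A2.
Qed.


(** [x] with its leaf [l] is the smallest corona, obtained from [star1 x] and attached at [t]. *)
Lemma core_leaf_child S A x t l : core S A -> t \in A -> adj t x -> adj x l ->
  exists2 A', core (l :: x :: S) A' & x \in A'.
Proof.
move=> h tA tx xl; have [A' h' sub] := core_attach h tA (star1 x) tx xl.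
exists A'; last by apply: sub; rewrite mem_cat mem_head orbT.
by apply: core_perm h' _; apply/permP=> P; rewrite /= count_cat /=; lia.
Qed.

Section Join.
Variables (x t : G) (S1 S2 : seq G) (d1 d2 : nat).
Hypothesis xt : adj x t.

(** With [x] selected, deficit 0 leaves only the edge [x t], with [t] as the leaf. For deficit 1,
    either [t] is the middle vertex of a bistar, or [x] with leaf [t] is attached to the center of a
    star. *)
Lemma deficit_shape_UU d : d1 + d2 = d.+2 ->
  deficit_shape Undominated d1 x S1 -> deficit_shape Undominated d2 t S2 ->
  deficit_shape Selected d x (S1 ++ S2).
Proof.
have tx : adj t x by rewrite adj_sym.
case: d => [|[|//]]; case: d1 => [|[|[|[|d1']]]] //; case: d2 => [|[|[|[|d2']]]] //= E h1 h2; try lia.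
- by exists t, 0, [:: x], [:: x]; rewrite h1 h2; split=> //; [exact: star1 | rewrite perm_catC].
- case: h2 => y [a [S' [A' [h ty p]]]]; exists ([:: x] ++ A'); last exact: mem_head.
  by rewrite h1; apply: core_bistar (star1 x) h tx ty _; perm_count p.
- case: h1 => y [a [S' [A' [h xy p]]]]; rewrite h2.
  have yx : adj y x by rewrite adj_sym.
  have [A'' h' xA] := core_leaf_child (star_core h) (star_center h) yx xt.
  by exists A'' => //; apply: core_perm h' _; perm_count p.
Qed.

Lemma deficit_shape_UD :
  deficit_shape Undominated d1 x S1 -> deficit_shape Dominated d2 t S2 ->
  deficit_shape Undominated (d1 + d2) x (S1 ++ S2).
Proof.
have tx : adj t x by rewrite adj_sym.
case: d1 => [|[|[|d1']]] //; case: d2 => [|[|[|d2']]] //=; rewrite ?addnS //=.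
- by move=> -> [a [A h]]; exists t, a, S2, A.
- move=> -> /(_ _ tx) [A h _]; exists A; exact: h.
- move=> [y [a [S' [A' [h xy p]]]]] [b [A h2]]; exists (A' ++ A).
  by apply: core_bistar h h2 xy xt _; perm_count p.
Qed.

(** For total deficit 2 the tree has an even number of vertices. The prospective leaf [l] restores
    the odd order of a core and makes [x] a corona vertex. *)
Lemma deficit_shape_US :
  deficit_shape Undominated d1 x S1 -> deficit_shape Selected d2 t S2 ->
  deficit_shape Dominated (d1 + d2) x (S1 ++ S2).
Proof.
have tx : adj t x by rewrite adj_sym.
case: d1 => [|[|[|d1']]] //; case: d2 => [|[|d2']] //=; rewrite ?addn0 ?addnS //=.
- move=> -> [l [a [S' [A' [h tl p]]]]]; exists (0 + a).+1, ([:: x] ++ A').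
  by apply: starJ (star1 x) h xt tl _; perm_count p.
- move=> -> [A h tA] l xl; have [A' h' xA] := core_leaf_child h tA tx xl.
  by exists A'.
- move=> [y [a [S' [A' [h xy p]]]]] [m [b [S'' [A'' [h2 tm q]]]]] l xl.
  have yx : adj y x by rewrite adj_sym.
  have [B hB sub] := star_attach (star1 x) (mem_head _ _) h2 xt tm.
  have [C hC subC] := core_attach (star_core h) (star_center h) hB yx xl.
  exists C; last by apply: subC; rewrite mem_cat (star_center hB) orbT.
  by apply: core_perm hC _; perm_count2 p q.
Qed.

Lemma deficit_shape_DU d : d1 + d2 = d.+2 ->
  deficit_shape Dominated d1 x S1 -> deficit_shape Undominated d2 t S2 ->
  deficit_shape Selected d x (S1 ++ S2).
Proof.
have tx : adj t x by rewrite adj_sym.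
case: d => [|[|//]]; case: d1 => [|[|[|[|d1']]]] //; case: d2 => [|[|[|[|d2']]]] //= E h1 h2; try lia.
- case: h1 => a [A h]; exists t, a, S1, A; rewrite h2; split=> //.
  by rewrite perm_catC.
- case: h1 => a [A h]; case: h2 => y [b [S' [A' [h2 ty p]]]]; exists (A ++ A').
    by apply: core_bistar h h2 tx ty _; perm_count p.
  by rewrite mem_cat (star_center h).
- have [A h xA] := h1 _ xt; exists A => //; rewrite h2.
  by apply: core_perm h _; rewrite perm_catC.
Qed.

Lemma deficit_shape_DD :
  deficit_shape Dominated d1 x S1 -> deficit_shape Dominated d2 t S2 ->
  deficit_shape Dominated (d1 + d2) x (S1 ++ S2).
Proof.
have tx : adj t x by rewrite adj_sym.
case: d1 => [|[|[|d1']]] //; case: d2 => [|[|[|d2']]] //=; rewrite ?addn0 ?addnS //=.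
move=> [a [A h]] [b [B h2]] l xl.
have [C h' sub] := star_attach h2 (star_center h2) h tx xl.
exists C; last by apply: sub; rewrite mem_cat (star_center h) orbT.
by apply: core_perm (star_core h') _; rewrite perm_cons perm_catC.
Qed.

Lemma deficit_shape_DS :
  deficit_shape Dominated d1 x S1 -> deficit_shape Selected d2 t S2 ->
  deficit_shape Dominated (d1 + d2) x (S1 ++ S2).
Proof.
have tx : adj t x by rewrite adj_sym.
case: d1 => [|[|[|d1']]] //; case: d2 => [|[|d2']] //=; rewrite ?addn0 ?addnS //=.
- move=> [a [A h]] [l [b [S' [A' [h2 tl p]]]]]; exists (a + b).+1, (A ++ A').
  by apply: starJ h h2 xt tl _; perm_count p.
- move=> [a [A h]] [B h2 tB] l xl.
  have [C h' sub] := core_attach h2 tB h tx xl; exists C.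
    by apply: core_perm h' _; rewrite perm_cons perm_catC.
  by apply: sub; rewrite mem_cat (star_center h) orbT.
- move=> h [m [b [S' [A' [h2 tm p]]]]] l xl; have [A h' xA] := h _ xl.
  have [C hC sub] := core_attach h' xA h2 xt tm; exists C.
    by apply: core_perm hC _; perm_count p.
  by apply: sub; rewrite mem_cat xA.
Qed.

Lemma deficit_shape_SU :
  deficit_shape Selected d1 x S1 -> deficit_shape Undominated d2 t S2 ->
  deficit_shape Selected (d1 + d2) x (S1 ++ S2).
Proof.
have tx : adj t x by rewrite adj_sym.
case: d1 => [|[|d1']] //; case: d2 => [|[|d2']] //=; rewrite ?addn0 ?addnS //=.
move=> [l [a [S' [A [h xl p]]]]] ->.
have [C hC sub] := star_attach (star1 t) (mem_head _ _) h tx xl.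
exists C; first by apply: core_perm (star_core hC) _; perm_count p.
by apply: sub; rewrite mem_cat (star_center h) orbT.
Qed.

Lemma deficit_shape_SD :
  deficit_shape Selected d1 x S1 -> deficit_shape Dominated d2 t S2 ->
  deficit_shape Selected (d1 + d2) x (S1 ++ S2).
Proof.
have tx : adj t x by rewrite adj_sym.
case: d1 => [|[|d1']] //; case: d2 => [|[|d2']] //=; rewrite ?addn0 ?addnS //=.
move=> [l [a [S' [A [h xl p]]]]] [b [B h2]].
have [C hC sub] := star_attach h2 (star_center h2) h tx xl.
exists C; first by apply: core_perm (star_core hC) _; perm_count p.
by apply: sub; rewrite mem_cat (star_center h) orbT.
Qed.

Lemma deficit_shape_SS :
  deficit_shape Selected d1 x S1 -> deficit_shape Selected d2 t S2 ->
  deficit_shape Selected (d1 + d2) x (S1 ++ S2).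
Proof.
have tx : adj t x by rewrite adj_sym.
case: d1 => [|[|d1']] //; case: d2 => [|[|d2']] //=; rewrite ?addn0 ?addnS //=.
- move=> [l [a [S' [A [h xl p]]]]] [m [b [S'' [B [h2 tm q]]]]].
  exists l, (a + b).+1, (m :: S' ++ S''), (A ++ B); split=> //; last by perm_count2 p q.
  exact: starJ h h2 xt tm (perm_refl _).
- move=> [l [a [S' [A [h xl p]]]]] [B h2 tB].
  have [C hC sub] := core_attach h2 tB h tx xl; exists C.
    by apply: core_perm hC _; perm_count p.
  by apply: sub; rewrite mem_cat (star_center h) orbT.
- move=> [B h2 xB] [m [b [S'' [A [h tm q]]]]].
  have [C hC sub] := core_attach h2 xB h xt tm; exists C.
    by apply: core_perm hC _; perm_count q.
  by apply: sub; rewrite mem_cat xB.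
Qed.

End Join.


(* Deficits add up along an edge, except when the root may be selected and
   thereby dominates both parts: this costs one vertex and lowers the deficit
   by 2. *)
Lemma rtree_deficit r S : rtree r S -> exists s d D,
  [/\ (size D).*2 + d = size S, partial_dominating s r S D & deficit_shape s d r S].
Proof.
elim=> [x|x S1 t S2 _ [s1 [d1 [D1 [sz1 dom1 sh1]]]] _ [s2 [d2 [D2 [sz2 dom2 sh2]]]] xt].
  by exists Undominated, 1, [::]; split=> // v; rewrite inE => ->.
have tx : adj t x by rewrite adj_sym.
case: s1 s2 dom1 dom2 sh1 sh2 => -[] /= dom1 dom2 sh1 sh2.
(* Deficit 0 occurs only at a selected root, so [d1] and [d2] are both positive here. *)
- have {}sh : exists d, d1 + d2 = d.+2.
    by case: d1 d2 sh1 sh2 {sz1 sz2} => [|d1] [|d2] //= _ _; exists (d1 + d2); lia.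
  have [d dE] := sh; exists Selected, d, (x :: D1 ++ D2); split.
  + by rewrite /= !size_cat; lia.
  + rewrite /= mem_head; split=> // v; rewrite mem_cat => /orP[vS|vS].
      have [->|vx] := eqVneq v x; first by [].
      by rewrite dominated_catl ?orbT // dom1.
    have [->|vx] := eqVneq v t; first by rewrite xt orbT.
    by rewrite dominated_catr ?orbT // dom2.
  + exact: deficit_shape_UU dE sh1 sh2.
- exists Undominated, (d1 + d2), (D1 ++ D2); split.
  + by rewrite !size_cat; lia.
  + move=> v; rewrite mem_cat => /orP[vS|vS] vx; first exact/dominated_catl/dom1.
    exact/dominated_catr/dom2.
  + exact: deficit_shape_UD sh1 sh2.
- case: dom2 => tD dom2; exists Dominated, (d1 + d2), (D1 ++ D2); split.
  + by rewrite !size_cat; lia.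
  + move=> v; rewrite mem_cat => /orP[vS|vS]; last exact/dominated_catr/dom2.
    have [->|vx] := eqVneq v x; last exact/dominated_catl/dom1.
    by apply/dominated_catr/dominated_adj; [exact: tD|].
  + exact: deficit_shape_US sh1 sh2.
- have {}sh : exists d, d1 + d2 = d.+2.
    by case: d1 d2 sh1 sh2 {sz1 sz2} => [|d1] [|d2] //= _ _; exists (d1 + d2); lia.
  have [d dE] := sh; exists Selected, d, (x :: D1 ++ D2); split.
  + by rewrite /= !size_cat; lia.
  + rewrite /= mem_head; split=> // v; rewrite mem_cat => /orP[vS|vS].
      by rewrite dominated_catl ?orbT // dom1.
    have [->|vx] := eqVneq v t; first by rewrite xt orbT.
    by rewrite dominated_catr ?orbT // dom2.
  + exact: deficit_shape_DU dE sh1 sh2.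
- exists Dominated, (d1 + d2), (D1 ++ D2); split.
  + by rewrite !size_cat; lia.
  + move=> v; rewrite mem_cat => /orP[vS|vS]; first exact/dominated_catl/dom1.
    exact/dominated_catr/dom2.
  + exact: deficit_shape_DD sh1 sh2.
- case: dom2 => tD dom2; exists Dominated, (d1 + d2), (D1 ++ D2); split.
  + by rewrite !size_cat; lia.
  + move=> v; rewrite mem_cat => /orP[vS|vS]; first exact/dominated_catl/dom1.
    exact/dominated_catr/dom2.
  + exact: deficit_shape_DS sh1 sh2.
- case: dom1 => xD dom1; exists Selected, (d1 + d2), (D1 ++ D2); split.
  + by rewrite !size_cat; lia.
  + rewrite /= mem_cat xD; split=> // v; rewrite mem_cat => /orP[vS|vS]; first exact/dominated_catl/dom1.
    have [->|vt] := eqVneq v t; last exact/dominated_catr/dom2.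
    by apply/dominated_catl/dominated_adj; [exact: xD|].
  + exact: deficit_shape_SU sh1 sh2.
- case: dom1 => xD dom1; exists Selected, (d1 + d2), (D1 ++ D2); split.
  + by rewrite !size_cat; lia.
  + rewrite /= mem_cat xD; split=> // v; rewrite mem_cat => /orP[vS|vS]; first exact/dominated_catl/dom1.
    exact/dominated_catr/dom2.
  + exact: deficit_shape_SD sh1 sh2.
- case: dom1 => xD dom1; exists Selected, (d1 + d2), (D1 ++ D2); split.
  + by rewrite !size_cat; lia.
  + rewrite /= mem_cat xD; split=> // v; rewrite mem_cat => /orP[vS|vS]; first exact/dominated_catl/dom1.
    by case: dom2 => _ dom2; exact/dominated_catr/dom2.
  + exact: deficit_shape_SS sh1 sh2.
Qed.

Lemma domination_number_le D : (forall v, dominated D v) -> domination_number G <= size D.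
Proof.
move=> dom; have [_ min_dom] := domination_numberP G.
apply: leq_trans (card_size D); rewrite -(cardsE (mem D)); apply: min_dom.
apply/forallP => v; apply/implyP => vD; apply/existsP.
have /hasP[u uD /orP[/eqP uv|uv]] := dom v; first by rewrite inE -uv uD in vD.
by exists u; rewrite inE uD.
Qed.

(** A dominating set has at least k elements, so a spanning tree whose root is dominated has deficit
    at most 1. An undominated root must first be added to the set, which allows deficit 3. *)
Lemma core_of_domination_number k : connected G -> 0 < k -> #|G| = k.*2.+1 ->
  domination_number G = k -> exists2 S, perm_eq S (enum G) & exists A, core S A.
Proof.
move=> [/card_gt0P[r _] conn] k0 cG dG.
have [S h p] := rtree_exists (conn r); exists S => //.
have inS v : v \in S by rewrite (perm_mem p) mem_enum.
have szS : size S = k.*2.+1 by rewrite (perm_size p) -cardE.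
have [s [d [D [szD dom sh]]]] := rtree_deficit h.
have domN D' : (forall v, v \in S -> dominated D' v) -> k <= size D'.
  by move=> domD'; rewrite -dG; apply: domination_number_le => v; exact: domD'.
case: s dom sh => /= dom sh.
- have : k <= size (r :: D).
    apply: domN => v vS; have [<-|vr] := eqVneq r v; first by rewrite /= eqxx.
    by rewrite -cat1s dominated_catr // dom // eq_sym.
  (* By parity the deficit is 1 or 3, and deficit 1 would make [G] a single vertex. *)
  case: d sh szD => [|[|[|[|d]]]] //=; try lia.
  by move=> S1; move: szS; rewrite S1 /=; lia.
- have := domN _ dom; case: d sh szD => [|[|[|d]]] //=; try lia.
  by move=> [a [A hst]] _ _; exists A; exact: star_core hst.
- have := domN _ dom.2; case: d sh szD => [|[|d]] //=; try lia.
  by move=> [A hA _] _ _; exists A.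
Qed.

End Domination.

(** * Spanning copies of the extremal tree *)

Lemma Ttree_connected i j : connected (Ttree (i + j).+3 i j).
Proof.
set m := (i + j).+3; set T := Ttree m i j.
split; first by apply/card_gt0P; exists (inl ord0).
have sym : connect_sym (@adj T) by apply: sym_connect_sym; exact: adj_sym.
suff root x : connect (@adj T) (inl ord0) x.
  by move=> x y; apply: connect_trans (root y); rewrite sym.
have path_root k (km : k < m) : connect (@adj T) (inl ord0) (inl (Ordinal km)).
  elim: k km => [|k IH] km; first by rewrite (_ : Ordinal km = ord0) //; exact: val_inj.
  apply: connect_trans (IH (ltnW km)) (connect1 _).
  by rewrite /= /pend_adj /= eqxx.
case: x => [[k km]|[a|b]]; first exact: path_root.
  have am : a < m by rewrite /m; have := ltn_ord a; lia.
  by apply: connect_trans (path_root _ am) (connect1 _); rewrite /= /pend_adj /= eqxx.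
have bm : i.+3 + b < m by rewrite /m; have := ltn_ord b; lia.
by apply: connect_trans (path_root _ bm) (connect1 _); rewrite /= /pend_adj /= /m; lia.
Qed.

Lemma card_Ttree m i j : #|Ttree m i j| = m + (i + j).
Proof. by rewrite card_sum card_sum !card_ord. Qed.

Lemma sorted_rev_cat (T : Type) (e : rel T) v s1 s2 : symmetric e ->
  sorted e (rev s1 ++ v :: s2) = path e v s1 && path e v s2.
Proof.
move=> sym; elim: s1 v s2 => [//|x s1 IH] v s2.
by rewrite rev_cons cat_rcons IH /= sym; case: (e v x); rewrite ?andbF.
Qed.

Lemma surj_bij (A B : finType) (f : A -> B) :
  (forall b, exists a, f a = b) -> #|A| = #|B| -> bijective f.
Proof.
move=> surj cAB; have [g gK] := fin_all_exists surj.
have inj_g : injective g by apply: can_inj gK.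
have /(bij_can_bij) : bijective g by apply: inj_card_bij => //; rewrite cAB.
by apply.
Qed.

Section PendantPaths.
Variable G : sgraph.
Implicit Types (x t u v w : G) (S : seq G) (s : seq (G * G)).

Fixpoint pendant_path x (s : seq (G * G)) : bool :=
  if s is (t, l) :: s' then [&& adj x t, adj t l & pendant_path t s'] else true.

Definition pendant_path_on x S a : Prop :=
  exists s, [/\ size s = a, pendant_path x s & perm_eq S (x :: unzip1 s ++ unzip2 s)].

(** This is the extremal tree read from its middle: [u], [v], [w] are the three path vertices
    without a pendant, at the 0-based positions i, i + 1, i + 2. *)
Definition double_pendant_path i j S : Prop :=
  exists v u w S1 S2, [/\ adj v u /\ adj v w, pendant_path_on u S1 i,
    pendant_path_on w S2 j & perm_eq S (v :: S1 ++ S2)].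

Lemma pendant_path_path x s : pendant_path x s -> path (@adj G) x (unzip1 s).
Proof. by elim: s x => [//|[t l] s IH] x /= /and3P[-> _ /IH]. Qed.

Lemma pendant_path_leaf x v s k : pendant_path x s -> k < size s ->
  adj (nth v (unzip1 s) k) (nth v (unzip2 s) k).
Proof. by elim: s x k => [//|[t l] s IH] x [|k] /= /and3P[_ tl /IH h]; [|exact: h]. Qed.

(** [G] may have further edges, so adjacency is only preserved. Since both graphs have the same
    order, surjectivity of [f] is enough for bijectivity. *)
Lemma double_pendant_path_hom i j S : double_pendant_path i j S -> perm_eq S (enum G) ->
  exists2 f : Ttree (i + j).+3 i j -> G, bijective f &
    forall a b : Ttree (i + j).+3 i j, adj a b -> adj (f a) (f b).
Proof.
move=> [v [u [w [S1 [S2 [[vu vw] [s1 [sz1 path1 p1]] [s2 [sz2 path2 p2]] pS]]]]]] pG.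
set m := (i + j).+3.
pose hs := rev (u :: unzip1 s1) ++ v :: (w :: unzip1 s2).
have sz_hs : size hs = m by rewrite /hs /m size_cat size_rev /= !size_map sz1 sz2; lia.
have sorted_hs : sorted (@adj G) hs.
  by rewrite sorted_rev_cat /=; [rewrite vu vw !pendant_path_path | exact: adj_sym].
pose f (x : Ttree m i j) : G := match x with
  | inl k => nth v hs k
  | inr (inl a) => nth v (rev (unzip2 s1)) a
  | inr (inr b) => nth v (unzip2 s2) b
  end.
have arc_adj (x y : Ttree m i j) : pend_arc x y -> adj (f x) (f y).
  rewrite /f; case: x y => [k|//] [l|[a|b]] /=.
  - by move=> /eqP kl; rewrite -kl; apply: (elimT (sortedP v) sorted_hs); rewrite sz_hs kl.
  - move=> /eqP->; have ai := ltn_ord a.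
    rewrite /hs rev_cons cat_rcons nth_cat size_rev size_map sz1 ai.
    rewrite !nth_rev ?size_map ?sz1 //.
    by apply: (pendant_path_leaf _ path1); lia.
  - move=> kb; have bj := ltn_ord b.
    have -> : (k : nat) = i.+3 + b by move: kb; rewrite /m; lia.
    rewrite /hs nth_cat size_rev /= size_map sz1 ifN; last by lia.
    rewrite (_ : i.+3 + b - i.+1 = b.+2) /=; last by lia.
    by apply: (pendant_path_leaf _ path2); lia.
exists f; last first.
  by move=> x y /orP[/arc_adj//|/arc_adj]; rewrite adj_sym.
have mem_hs x : x \in hs -> exists a, f a = x.
  move=> xh; have xm : index x hs < m by rewrite -sz_hs index_mem.
  by exists (inl (Ordinal xm)); rewrite /= nth_index.
apply: surj_bij => [x|]; last first.
  rewrite card_Ttree cardE -(perm_size pG) (perm_size pS) /= size_cat.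
  rewrite (perm_size p1) (perm_size p2) /= !size_cat !size_map sz1 sz2 /m; lia.
have : x \in S by rewrite (perm_mem pG) mem_enum.
rewrite (perm_mem pS) inE mem_cat (perm_mem p1) (perm_mem p2) !inE !mem_cat.
have hs_mem z : (z \in hs) = [|| z \in unzip1 s1, z == u, z == v, z == w | z \in unzip1 s2].
  by rewrite mem_cat mem_rev !inE -!orbA [LHS]orbCA.
have [|] := boolP (x \in hs); first by move=> /mem_hs.
rewrite hs_mem !negb_or => /and5P[/negPf-> /negPf-> /negPf-> /negPf-> /negPf->] /=.
move=> /orP[xl|xl].
  have xi : index x (rev (unzip2 s1)) < i by rewrite -sz1 -(size_map snd) -size_rev index_mem mem_rev.
  by exists (inr (inl (Ordinal xi))); rewrite /= nth_index // mem_rev.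
have xj : index x (unzip2 s2) < j by rewrite -sz2 -(size_map snd) index_mem.
by exists (inr (inr (Ordinal xj))); rewrite /= nth_index.
Qed.

End PendantPaths.

Local Open Scope ring_scope.

(** * Spectral estimates for positive supersolutions *)

Section Chebyshev.
Variables (R : realFieldType) (mu : R).

(* [cheb n] is U_(n-1)(mu/2), hence [cheb n.+1] is the characteristic polynomial
   at [mu] of the path on n vertices. *)
Fixpoint cheb n : R :=
  if n is n'.+1 then (if n' is n''.+1 then mu * cheb n' - cheb n'' else 1) else 0.

Lemma cheb0 : cheb 0 = 0.
Proof. by []. Qed.

Lemma cheb1 : cheb 1 = 1.
Proof. by []. Qed.

Lemma chebSS n : cheb n.+2 = mu * cheb n.+1 - cheb n.
Proof. by []. Qed.

Local Arguments cheb : simpl never.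

(** This expands the characteristic polynomial of a path on a + b vertices at the edge between the
    first a and the last b of them. *)
Lemma cheb_add a b : cheb (a + b).+1 = cheb a.+1 * cheb b.+1 - cheb a * cheb b.
Proof.
suff [//]: cheb (a + b).+1 = cheb a.+1 * cheb b.+1 - cheb a * cheb b /\
    cheb (a.+1 + b).+1 = cheb a.+2 * cheb b.+1 - cheb a.+1 * cheb b.
elim: a => [|a [IH1 IH2]]; first by rewrite !add0n !(chebSS, cheb0, cheb1); split; ring.
split=> //; rewrite !addSn chebSS -!addSn IH2 addSn IH1 !chebSS; ring.
Qed.

(** The recurrence has determinant 1, so the left side does not depend on [b]. *)
Lemma cheb_cross b c :
  cheb (b + c).+3 * cheb b.+1 - cheb (b + c).+2 * cheb b.+2 = - cheb c.+1.
Proof.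
elim: b => [|b IH]; first by rewrite add0n !(chebSS, cheb0, cheb1); ring.
by rewrite -IH addSn (chebSS (b + c).+2) (chebSS b.+1); ring.
Qed.

Lemma cheb_cassini b : cheb b.+1 ^+ 2 - cheb b * cheb b.+2 = 1.
Proof.
elim: b => [|b IH]; first by rewrite chebSS cheb0 cheb1; ring.
by rewrite -IH (chebSS b.+1) (chebSS b); ring.
Qed.

(** By the Sturm property this means that [mu] exceeds the spectral radius of the path on n
    vertices. *)
Definition cheb_pos n := forall c, (c <= n)%N -> 0 < cheb c.+1.

(** Where the denominators are nonzero, this is the continued fraction p_0 = 0, p_(n+1) = 1 / (mu -
    p_n). *)
Definition cheb_ratio n := cheb n / cheb n.+1.

Lemma cheb_pos_le m n : (m <= n)%N -> cheb_pos n -> cheb_pos m.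
Proof. by move=> mn h c cm; apply: h; exact: leq_trans cm mn. Qed.

Lemma cheb_posS n : cheb_pos n -> 0 < cheb n.+2 -> cheb_pos n.+1.
Proof. by move=> h h' c; rewrite leq_eqVlt => /orP[/eqP->//|]; exact: h. Qed.

Lemma sub_cheb_ratio n : 0 < cheb n.+1 -> mu - cheb_ratio n = cheb n.+2 / cheb n.+1.
Proof. by move=> h; rewrite /cheb_ratio chebSS; field; rewrite lt0r_neq0. Qed.

Lemma cheb_ratio_leS n : cheb_pos n.+1 -> cheb_ratio n <= cheb_ratio n.+1.
Proof.
move=> h; have h1 := h n (leqnSn n); have h2 := h n.+1 (leqnn _).
rewrite -subr_ge0.
have -> : cheb_ratio n.+1 - cheb_ratio n = 1 / (cheb n.+1 * cheb n.+2).
  by rewrite -(cheb_cassini n) /cheb_ratio; field; rewrite !lt0r_neq0.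
by rewrite divr_ge0 // mulr_ge0 // ltW.
Qed.

Lemma cheb_ratio_le m n : (m <= n)%N -> cheb_pos n -> cheb_ratio m <= cheb_ratio n.
Proof.
elim: n => [|n IH]; first by rewrite leqn0 => /eqP->.
rewrite leq_eqVlt => /orP[/eqP->//|mn] h.
by apply: le_trans (IH mn (cheb_pos_le (leqnSn n) h)) (cheb_ratio_leS h).
Qed.

Lemma cheb_ratio_addE a b : 0 < cheb a.+1 -> 0 < cheb b.+1 ->
  cheb_ratio a + cheb_ratio b = mu - cheb (a + b).+2 / (cheb a.+1 * cheb b.+1).
Proof.
move=> ha hb; rewrite -addSn cheb_add chebSS /cheb_ratio.
by field; rewrite !lt0r_neq0.
Qed.

Lemma cheb_ratio_sub_add a b : 0 < cheb a.+1 -> 0 < cheb b.+1 -> 0 < cheb (a + b).+1 ->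
  cheb_ratio a + cheb_ratio b - cheb_ratio (a + b) =
  cheb (a + b).+2 * (cheb a * cheb b) / (cheb a.+1 * cheb b.+1 * cheb (a + b).+1).
Proof.
move=> ha hb hab; rewrite cheb_ratio_addE // addrAC sub_cheb_ratio //.
have -> : cheb a * cheb b = cheb a.+1 * cheb b.+1 - cheb (a + b).+1.
  by rewrite cheb_add; ring.
by field; rewrite !lt0r_neq0.
Qed.

(** This is why a single path minimizes the neighbor sum at the center of a star: merging two
    branches into one can only lower it. *)
Lemma cheb_ratio_add a b : cheb_pos (a + b).+1 -> cheb_ratio (a + b) <= cheb_ratio a + cheb_ratio b.
Proof.
move=> h; rewrite -subr_ge0 cheb_ratio_sub_add; try (apply: h; lia).
have nneg m : (m <= a + b)%N -> 0 <= cheb m.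
  by case: m => [|m] ?; [rewrite cheb0 | apply/ltW/h; lia].
by rewrite divr_ge0 // ?mulr_ge0 //; try (apply: nneg; lia); apply/ltW/h; lia.
Qed.

Lemma cheb_ratio_add_eq a b : cheb_pos (a + b).+1 -> cheb_ratio a + cheb_ratio b = cheb_ratio (a + b) ->
  a = 0%N \/ b = 0%N.
Proof.
move=> h /eqP; rewrite -subr_eq0 cheb_ratio_sub_add; try (apply: h; lia).
case: a b h => [|a] [|b] h; try (by left); try (by right).
rewrite gt_eqF // divr_gt0 // ?mulr_gt0 //; apply: h; lia.
Qed.

(** At a length where [cheb (a + b).+2] is nonpositive the bound is [cheb_ratio_addE]; monotonicity
    of the ratio carries it on to larger [b]. *)
Lemma cheb_ratio_add_ge a b : cheb_pos a.+1 -> cheb_pos b -> ~ cheb_pos (a + b).+1 ->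
  mu <= cheb_ratio a + cheb_ratio b.
Proof.
elim: b => [|b IH] ha hb; first by rewrite addn0.
case: (lerP (cheb (a + b).+3) 0) => hab; last first.
  move=> hn; apply: le_trans (IH ha (cheb_pos_le (leqnSn b) hb) _) _.
    by move=> h; apply: hn; rewrite addnS; exact: cheb_posS.
  by rewrite lerD2l; exact: cheb_ratio_leS.
move=> _; rewrite cheb_ratio_addE; [|exact: ha|exact: hb].
rewrite addnS lerDl oppr_ge0 mulr_le0_ge0 // invr_ge0 mulr_ge0 // ltW //; [exact: ha|exact: hb].
Qed.

End Chebyshev.

Arguments cheb {R} mu n : simpl never.

Lemma sumr_le_uniq (R : numDomainType) (I : finType) (P : pred I) (F : I -> R) (s : seq I) :
  (forall i, 0 <= F i) -> uniq s -> \sum_(i <- s | P i) F i <= \sum_(i | P i) F i.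
Proof.
move=> F0 us; rewrite -big_filter big_uniq ?filter_uniq //= [leRHS](bigID (mem s)) /=.
under eq_bigl => i do rewrite mem_filter.
by rewrite lerDl sumr_ge0.
Qed.

Lemma ler_sum_mem (R : numDomainType) (I : eqType) (P : pred I) (F : I -> R) (s : seq I) j :
  (forall i, 0 <= F i) -> j \in s -> P j -> F j <= \sum_(i <- s | P i) F i.
Proof. by move=> F0 js Pj; rewrite (big_rem j) //= Pj lerDl sumr_ge0. Qed.

(** * Neighbor sums at the center of a star *)

Section Supersolution.
Variables (R : realFieldType) (G : sgraph) (y : G -> R) (lam : R).
Hypothesis y_gt0 : forall v, 0 < y v.
Hypothesis lam_gt0 : 0 < lam.
Hypothesis y_super : forall v, \sum_(u | adj v u) y u <= lam * y v.
Implicit Types (x t u v w l : G) (S A : seq G).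

Let mu := lam - lam^-1.
Let p := cheb_ratio mu.

Let y_ge0 v : 0 <= y v. Proof. exact/ltW. Qed.

Definition nbr_sum S v : R := \sum_(u <- S | adj v u) y u.

Lemma nbr_sum_super S v : uniq S -> nbr_sum S v <= lam * y v.
Proof. by move=> uS; apply: le_trans (y_super v); exact: sumr_le_uniq. Qed.

Lemma nbr_sum_ge0 S v : 0 <= nbr_sum S v.
Proof. by rewrite sumr_ge0. Qed.

Lemma nbr_sum_mem S v u : u \in S -> adj v u -> y u <= nbr_sum S v.
Proof. by move=> *; exact: ler_sum_mem. Qed.

Lemma nbr_sum_cat S1 S2 v : nbr_sum (S1 ++ S2) v = nbr_sum S1 v + nbr_sum S2 v.
Proof. by rewrite /nbr_sum big_cat. Qed.

Lemma nbr_sum_perm S1 S2 v : perm_eq S1 S2 -> nbr_sum S1 v = nbr_sum S2 v.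
Proof. by move=> h; rewrite /nbr_sum (perm_big _ h). Qed.

Lemma star_mem x a S A : star x a S A -> x \in S.
Proof.
elim=> [v|v a' S1 A1 t b S2 A2 l T _ IH _ _ _ _ /perm_mem->]; first exact: mem_head.
by rewrite inE mem_cat IH orbT.
Qed.

Lemma leaf_ge t l : adj t l -> y t / lam <= y l.
Proof.
move=> tl; rewrite ler_pdivrMr // mulrC; apply: le_trans (y_super l).
by rewrite (bigD1 t) 1?adj_sym //= lerDl sumr_ge0.
Qed.

(** The leaf contributes at least [y t / lam] to the sum at [t], which turns [lam] into [mu]. *)
Lemma star_child x t S S' l : adj x t -> adj t l -> uniq (l :: S ++ S') -> x \in S ->
  y x + nbr_sum S' t <= mu * y t.
Proof.
move=> xt tl u xS; have := nbr_sum_super t u; have := leaf_ge tl.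
rewrite -cat1s !nbr_sum_cat.
have := @nbr_sum_mem [:: l] t l (mem_head _ _) tl.
have := @nbr_sum_mem S t x xS; rewrite adj_sym => /(_ xt).
by rewrite /mu mulrBl [lam^-1 * _]mulrC; lra.
Qed.

(** One step of the continued fraction: [p b.+1] is the inverse of [mu - p b]. *)
Lemma star_child_ratio x t S S' l b : adj x t -> adj t l -> uniq (l :: S ++ S') -> x \in S ->
  cheb_pos mu b.+1 -> p b * y t <= nbr_sum S' t -> p b.+1 * y x <= y t.
Proof.
move=> xt tl u xS hb h; have := star_child xt tl u xS.
have hb0 := hb b (leqnSn b); have hb1 := hb b.+1 (leqnn _).
move=> h1; have : y x <= (mu - p b) * y t by rewrite mulrBl; lra.
by rewrite /p sub_cheb_ratio // -invf_div ler_pdivlMl ?divr_gt0 // mulrC.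
Qed.

(* The first alternative covers the lengths for which even a path would have
   spectral radius at least [mu], so that the ratios lose their meaning. *)
Lemma star_bound x a S A : star x a S A -> uniq S ->
  mu * y x <= nbr_sum S x \/
  [/\ cheb_pos mu a.+1, p a * y x <= nbr_sum S x
    & p a * y x = nbr_sum S x -> pendant_path_on x S a].
Proof.
elim=> [v|v a' S1 A1 t b S2 A2 l T h1 IH1 h2 IH2 vt tl pm] uS.
  case: (lerP mu 0) => mu0; [left|right].
    by apply: le_trans (nbr_sum_ge0 _ _); rewrite mulr_le0_ge0.
  split.
  - by case=> [|[|//]] _; rewrite ?chebSS ?cheb1 ?cheb0 ?mulr1 ?subr0.
  - by rewrite /p /cheb_ratio cheb0 !mul0r nbr_sum_ge0.
  - by move=> _; exists [::].
have ul : uniq (l :: S1 ++ S2) by rewrite -(perm_uniq pm).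
have vS1 := star_mem h1; have tS2 := star_mem h2.
have [uS1 uS2] : uniq S1 /\ uniq S2 by move: ul; rewrite cons_uniq cat_uniq; case/and4P.
have child := star_child vt tl ul vS1.
have sumT : nbr_sum S1 v + y t <= nbr_sum T v.
  rewrite (nbr_sum_perm _ pm) -cat1s !nbr_sum_cat.
  by have := nbr_sum_mem tS2 vt; have := nbr_sum_ge0 [:: l] v; lra.
(* The first alternative at [t] contradicts [child], since [y v] is positive. *)
have [|[posb ratb eqb]] := IH2 uS2; first by move: (y_gt0 v); lra.
have yt := star_child_ratio vt tl ul vS1 posb ratb.
have [big|[posa rata eqa]] := IH1 uS1; first by left; move: (y_gt0 t); lra.
have [posab|nposab] := pselect (cheb_pos mu (a' + b.+1).+1); last first.
  left; have := cheb_ratio_add_ge posa posb nposab.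
  by rewrite -(ler_pM2r (y_gt0 v)) mulrDl -!/(p _); lra.
have rab := cheb_ratio_add posab.
have := rab; rewrite -(ler_pM2r (y_gt0 v)) mulrDl -!/(p _) => rabv.
right; rewrite -addnS; split=> //; first lra.
move=> eqT.
have eqr : p a' + p b.+1 = p (a' + b.+1)%N.
  by apply/(mulIf (lt0r_neq0 (y_gt0 v))); rewrite mulrDl; lra.
(* Equality leaves a single branch at the center, and [b.+1] is nonzero. *)
have a0 : a' = 0%N by case: (cheb_ratio_add_eq posab eqr).
have S1E : S1 = [:: v].
  move: (star_size h1) vS1; rewrite a0; case: (S1) => [//|z [|//]] _.
  by rewrite inE => /eqP->.
have ytE : y t = p b.+1 * y v by move: eqT; rewrite a0 add0n; move: (nbr_sum_ge0 S1 v); lra.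
(* Equality descends to [t]: as [y t] takes its least value, [child] bounds the neighbor sum at [t]
   by [p b * y t]. *)
have [s [sz path_s perm_s]] : pendant_path_on t S2 b.
  apply: eqb; apply/eqP; rewrite eq_le ratb /=.
  have : (mu - p b) * y t = y v.
    rewrite ytE /p sub_cheb_ratio; last exact: posb.
    rewrite /cheb_ratio; field.
    by rewrite !lt0r_neq0 //; apply: posb.
  by rewrite mulrBl; lra.
exists ((t, l) :: s); split; first by rewrite /= sz a0.
  by rewrite /= vt tl.
by apply: perm_trans pm _; rewrite S1E; move: perm_s; clear; move=> perm_s; perm_count perm_s.
Qed.

End Supersolution.

(** By [cheb_cross], moving one unit from the longer index to the shorter raises the product by a
    positive Chebyshev value. *)
Lemma cheb_prod_lt (R : realFieldType) (mu : R) I J a b :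
  (I + J = a + b)%N -> (b < J)%N -> (J <= I)%N -> cheb_pos mu a ->
  cheb mu a.+1 * cheb mu b.+1 < cheb mu I.+1 * cheb mu J.+1.
Proof.
move=> sumE; have [d] : exists d, (J - b)%N = d.+1 \/ (J - b)%N = 0%N.
  by case: (J - b)%N => [|d]; [exists 0%N; right | exists d; left].
case=> [dE|]; last by lia.
have -> : a = (I + d.+1)%N by lia.
have {dE} -> : J = (b + d.+1)%N by lia.
move=> {sumE} _; elim: d b => [|d IH] b bI posa.
  have := cheb_cross mu b (I - b.+1); have := posa (I - b.+1)%N.
  rewrite (_ : (b + (I - b.+1)) = I.-1)%N; last lia.
  rewrite (_ : I.-1.+3 = (I + 1).+1)%N; last lia.
  rewrite (_ : I.-1.+2 = I.+1)%N; last lia.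
  rewrite (_ : (I - b.+1).+1 = I - b)%N; last lia.
  have cI : (I - b.+1 <= I + 1)%N by lia.
  by move=> /(_ cI); rewrite [(b + 1)%N]addn1; lra.
have : cheb mu (I + d.+2).+1 * cheb mu b.+1 < cheb mu (I + d.+1).+1 * cheb mu b.+2.
  have := cheb_cross mu b (I + d - b); have := posa (I + d - b)%N.
  rewrite (_ : (b + (I + d - b)) = I + d)%N; last lia.
  have cI : (I + d - b <= I + d.+2)%N by lia.
  by move=> /(_ cI); rewrite !addnS; lra.
move=> /lt_trans; apply; rewrite (_ : (b + d.+2 = b.+1 + d.+1)%N); last by lia.
by apply: IH; [lia | apply: cheb_pos_le posa; lia].
Qed.

(** * Extremality of balanced arms *)

Section TwoArms.
Variables (R : realFieldType) (lam : R).
Hypothesis lam_gt0 : 0 < lam.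
Let mu := lam - lam^-1.
Let p := cheb_ratio mu.

(* For fixed [a + b] the right-hand side depends on [a] and [b] only through the
   product [cheb mu a.+1 * cheb mu b.+1], which is largest for balanced arms. *)
Lemma two_arm_charpoly a b : 0 < cheb mu a.+1 -> 0 < cheb mu b.+1 ->
  (lam * (lam - p a) * (lam - p b) - (lam - p a) - (lam - p b)) *
    (cheb mu a.+1 * cheb mu b.+1) =
  mu * (cheb mu a.+1 * cheb mu b.+1) + (lam ^+ 2 - 1) * cheb mu (a + b).+2
    - lam * cheb mu (a + b).+1.
Proof.
move=> ha hb; rewrite -addSn !cheb_add chebSS /p /cheb_ratio.
have -> : mu = lam - lam^-1 by [].
by field; rewrite !lt0r_neq0.
Qed.

Variables i j : nat.
Hypothesis ji : (j <= i <= j.+1)%N.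
Hypothesis pos_i : cheb_pos mu i.+1.
Hypothesis lam_gtp : 0 < lam - p i /\ 0 < lam - p j.
Hypothesis lam_eq : lam * (lam - p i) * (lam - p j) = (lam - p i) + (lam - p j).

Let mu_gt0 : 0 < mu.
Proof. by have := pos_i (isT : (1 <= i.+1)%N); rewrite chebSS cheb1 cheb0 mulr1 subr0. Qed.

(** By [two_arm_charpoly], the difference of the two sides times the Chebyshev product is an
    increasing affine function of that product, and it vanishes at (i, j) by [lam_eq]. *)
Lemma unbalanced_arms a b : (a + b = i + j)%N -> (b < j)%N -> cheb_pos mu a ->
  lam * (lam - p a) * (lam - p b) < (lam - p a) + (lam - p b).
Proof.
move=> sumE bj posa; have /andP[ji1 ij1] := ji.
have ha := posa a (leqnn a); have hb : 0 < cheb mu b.+1 by apply: posa; lia.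
have hi : 0 < cheb mu i.+1 by apply: pos_i; lia.
have hj : 0 < cheb mu j.+1 by apply: pos_i; lia.
have := cheb_prod_lt (esym sumE) bj ji1 posa; rewrite -(ltr_pM2l mu_gt0) => lt_prod.
have eq_ij := two_arm_charpoly hi hj; have eq_ab := two_arm_charpoly ha hb.
have F0 : lam * (lam - p i) * (lam - p j) - (lam - p i) - (lam - p j) = 0.
  by rewrite lam_eq; ring.
rewrite F0 mul0r in eq_ij; rewrite sumE in eq_ab.
suff : lam * (lam - p a) * (lam - p b) - (lam - p a) - (lam - p b) < 0 by lra.
by rewrite -(pmulr_llt0 _ (mulr_gt0 ha hb)) eq_ab; lra.
Qed.

(* Compares the star with two path arms of lengths [i] and [j.+1] to the
   double star with arms [i] and [j], which is critical at [lam]. *)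
Lemma balanced_spider : lam - p i - p j.+1 = - (p j * p j.+1 / lam).
Proof.
have /andP[ji1 ij1] := ji.
have hj : 0 < cheb mu j.+1 by apply: pos_i; lia.
have hj' : 0 < cheb mu j.+2 by apply: pos_i; lia.
have inv_p : p j.+1 * (lam - p j) = 1 + p j.+1 / lam.
  have : p j.+1 * (mu - p j) = 1.
    by rewrite /p sub_cheb_ratio // /cheb_ratio; field; rewrite !lt0r_neq0.
  by rewrite -[X in _ = X -> _]/(1); rewrite /mu => <-; field; rewrite lt0r_neq0.
have lam0 : lam != 0 by rewrite lt0r_neq0.
have alpha : (lam - p i) * lam = 1 + p j.+1 / lam.
  move: lam_eq inv_p; move: (lam - p i) (lam - p j) (p j.+1) => A B P eqAB eqPB.
  apply: (addIr (P * A)); transitivity (A * lam * (1 + P / lam)); first by field.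
  have -> : A * lam * (1 + P / lam) = P * (lam * A * B) by rewrite -eqPB; ring.
  by rewrite eqAB mulrDr eqPB addrC.
apply: (mulIf lam0); rewrite mulrBl alpha -inv_p.
by field.
Qed.

Lemma spider_ratio a b : 0 < cheb mu a.+1 -> 0 < cheb mu b.+1 ->
  (lam - p a - p b) * (cheb mu a.+1 * cheb mu b.+1) =
  cheb mu (a + b).+2 + cheb mu a.+1 * cheb mu b.+1 / lam.
Proof.
move=> ha hb; rewrite -addrA -opprD /p cheb_ratio_addE // /mu.
by field; rewrite !lt0r_neq0.
Qed.

Lemma cheb_prod_le_balanced a b : (a + b = (i + j).+1)%N -> (b <= a)%N -> cheb_pos mu a ->
  cheb mu a.+1 * cheb mu b.+1 <= cheb mu i.+1 * cheb mu j.+2 ?= iff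
  ((a == i) && (b == j.+1) || (a == j.+1) && (b == i)).
Proof.
move=> sumE ba posa; have /andP[ji1 ij1] := ji; apply/leifP.
case: ifPn => [/orP[] /andP[/eqP-> /eqP->]|neq]; rewrite ?eqxx //.
  by rewrite mulrC.
(* If i = j, the longer of the balanced arms is [j.+1], so the factors trade places. *)
have [eij|neij] := eqVneq i j; last by apply: cheb_prod_lt => //; lia.
by rewrite [ltRHS]mulrC; apply: cheb_prod_lt => //; lia.
Qed.

(** For fixed [a + b], the right-hand side of [spider_ratio] increases with the Chebyshev product;
    at the largest product its value is nonpositive by [balanced_spider]. *)
Lemma unbalanced_spider a b : (a + b = (i + j).+1)%N -> (1 < b)%N ->
  cheb_pos mu a -> cheb_pos mu b -> lam < p a + p b.
Proof.
move=> sumE b1 posa posb; have /andP[ji1 ij1] := ji.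
have ha := posa a (leqnn a); have hb := posb b (leqnn b).
have hi : 0 < cheb mu i.+1 by apply: pos_i; lia.
have hj : 0 < cheb mu j.+1 by apply: pos_i; lia.
have hj' : 0 < cheb mu j.+2 by apply: pos_i; lia.
have base := spider_ratio hi hj'; have eq_ab := spider_ratio ha hb.
rewrite balanced_spider in base; rewrite sumE -(addnS i j) in eq_ab.
suff : cheb mu (i + j.+1).+2 + cheb mu a.+1 * cheb mu b.+1 / lam < 0.
  by rewrite -eq_ab pmulr_llt0; [lra | exact: mulr_gt0].
have prod_le : cheb mu a.+1 * cheb mu b.+1 <= cheb mu i.+1 * cheb mu j.+2 ?= iff
  ((a == i) && (b == j.+1) || (a == j.+1) && (b == i)).
  case/orP: (leq_total a b) => ab; last exact: cheb_prod_le_balanced.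
  by rewrite mulrC orbC andbC [X in _ || X]andbC; apply: cheb_prod_le_balanced => //; rewrite addnC.
have := prod_le.1; rewrite -(ler_pM2r (_ : 0 < lam^-1)) ?invr_gt0 // => le_lam.
(* For j = 0 the balanced value is 0, and strictness comes from the product: [1 < b] rules out the
   balanced pair. *)
have [j0|j0] := posnP j.
  have nE : (a == i) && (b == j.+1) || (a == j.+1) && (b == i) = false.
    by clear -sumE b1 j0 ij1; lia.
  have := lt_leif prod_le; rewrite nE -(ltr_pM2r (_ : 0 < lam^-1)) ?invr_gt0 //.
  move: base; rewrite j0 {1}/p /cheb_ratio cheb0 !mul0r oppr0 mul0r; lra.
have pj : 0 < p j.
  rewrite /p /cheb_ratio divr_gt0 //; case: (j) j0 pos_i ji1 => // j' _ h ?; apply: h; exact: ltnW (leqW _).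
have pj' : 0 < p j.+1 by rewrite /p /cheb_ratio divr_gt0.
suff : - (p j * p j.+1 / lam) * (cheb mu i.+1 * cheb mu j.+2) < 0 by lra.
rewrite mulNr oppr_lt0; repeat apply: mulr_gt0 => //; by rewrite invr_gt0.
Qed.

End TwoArms.

(** * Cores that carry a supersolution at the critical value *)

Section CoreIsPath.
Variables (R : realFieldType) (G : sgraph) (y : G -> R) (lam : R).
Hypothesis y_gt0 : forall v, 0 < y v.
Hypothesis lam_gt0 : 0 < lam.
Hypothesis y_super : forall v, \sum_(u | adj v u) y u <= lam * y v.
Implicit Types (x t u v w l : G) (S A : seq G).

Let mu := lam - lam^-1.
Let p := cheb_ratio mu.

Variables i j : nat.
Hypothesis ji : (j <= i <= j.+1)%N.
Hypothesis pos_i : cheb_pos mu i.+1.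
Hypothesis lam_gtp : 0 < lam - p i /\ 0 < lam - p j.
Hypothesis lam_eq : lam * (lam - p i) * (lam - p j) = (lam - p i) + (lam - p j).

(** In the first alternative of [star_bound], the inequality at [u] would leave y v <= y u / lam,
    against the last hypothesis. *)
Lemma bistar_arm v u S1 S2 a A1 : star u a S1 A1 -> adj v u -> uniq (v :: S1 ++ S2) ->
  y u < lam * y v ->
  [/\ cheb_pos mu a.+1, y v <= (lam - p a) * y u
    & y v = (lam - p a) * y u -> pendant_path_on u S1 a].
Proof.
move=> h vu uS lt_u.
have uS1 : uniq S1 by move: uS; rewrite cons_uniq cat_uniq; case/and4P.
have sumu : y v + nbr_sum y S1 u <= lam * y u.
  have := nbr_sum_super y_gt0 y_super u uS; rewrite -cat1s !nbr_sum_cat.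
  have := nbr_sum_ge0 y_gt0 S2 u.
  have := @nbr_sum_mem _ _ _ y_gt0 [:: v] u v (mem_head _ _); rewrite adj_sym => /(_ vu).
  lra.
have [big|[posa rata eqa]] := star_bound y_gt0 lam_gt0 y_super h uS1.
  suff : lam * y v <= y u by rewrite leNgt lt_u.
  by rewrite -(ler_pM2r (_ : 0 < lam^-1)) ?invr_gt0 // mulrAC divff ?lt0r_neq0 //; move: big; rewrite mulrBl; lra.
rewrite -/mu -/p in rata eqa; split=> //; first by rewrite mulrBl; lra.
by rewrite mulrBl => eqv; apply: eqa; lra.
Qed.

(** Eliminating [y] from the inequalities at [u], [v] and [w] gives [char_ge], the opposite of
    [unbalanced_arms]. *)
Lemma bistar_path_sorted a b v u w S1 A1 S2 A2 : (a + b = i + j)%N -> (b <= a)%N ->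
  star u a S1 A1 -> star w b S2 A2 -> adj v u -> adj v w -> uniq (v :: S1 ++ S2) ->
  [/\ a = i, b = j, pendant_path_on u S1 a & pendant_path_on w S2 b].
Proof.
move=> sumE ba h1 h2 vu vw uS.
have uS' : uniq (v :: S2 ++ S1) by move: uS; rewrite /= !mem_cat orbC uniq_catC.
have sum_uw : y u + y w <= lam * y v.
  apply: le_trans (nbr_sum_super y_gt0 y_super v uS).
  rewrite -cat1s !nbr_sum_cat -[leLHS]add0r lerD ?nbr_sum_ge0 //.
  by rewrite lerD // nbr_sum_mem // ?(star_mem h1) ?(star_mem h2).
have [posa yu equ] := bistar_arm h1 vu uS (ltac:(have := y_gt0 w; lra)).
have [posb yw eqw] := bistar_arm h2 vw uS' (ltac:(have := y_gt0 u; lra)).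
have yv := y_gt0 v; have yu0 := y_gt0 u; have yw0 := y_gt0 w.
have al0 : 0 < lam - p a by rewrite -(pmulr_lgt0 _ yu0); lra.
have be0 : 0 < lam - p b by rewrite -(pmulr_lgt0 _ yw0); lra.
have char_ge : (lam - p a) + (lam - p b) <= lam * (lam - p a) * (lam - p b).
  rewrite -(ler_pM2r yv).
  have h3 : y v * (lam - p b) <= (lam - p a) * y u * (lam - p b) by rewrite ler_pM2r.
  have h4 : y v * (lam - p a) <= (lam - p b) * y w * (lam - p a) by rewrite ler_pM2r.
  have h5 : (y u + y w) * ((lam - p a) * (lam - p b)) <= lam * y v * ((lam - p a) * (lam - p b)).
    by rewrite ler_pM2r // mulr_gt0.
  move: h3 h4 h5; move: (lam - p a) (lam - p b) => A B; lra.
have posa' := cheb_pos_le (leqnSn a) posa.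
have bj : (j <= b)%N.
  rewrite leqNgt; apply/negP => bj.
  by have := unbalanced_arms lam_gt0 ji pos_i lam_gtp lam_eq sumE bj posa'; rewrite -/mu -/p; lra.
have [ai bj'] : a = i /\ b = j by clear -sumE ba bj ji; lia.
subst a b.
have h5 : (y u + y w) * ((lam - p i) * (lam - p j)) <= lam * y v * ((lam - p i) * (lam - p j)).
  by rewrite ler_pM2r // mulr_gt0.
have h6 : lam * y v * ((lam - p i) * (lam - p j)) = y v * (lam - p i + (lam - p j)).
  by rewrite -lam_eq; ring.
(* At (i, j) everything is tight: a strict inequality at [u] or [w] would contradict [lam_eq]. *)
split=> //.
  apply: equ; apply/eqP; rewrite eq_le yu leNgt /=; apply/negP => lt_u.
  have h3 : y v * (lam - p j) < (lam - p i) * y u * (lam - p j) by rewrite ltr_pM2r.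
  have h4 : y v * (lam - p i) <= (lam - p j) * y w * (lam - p i) by rewrite ler_pM2r.
  by move: h3 h4 h5 h6; move: (lam - p i) (lam - p j) => A B; lra.
apply: eqw; apply/eqP; rewrite eq_le yw leNgt /=; apply/negP => lt_w.
have h3 : y v * (lam - p j) <= (lam - p i) * y u * (lam - p j) by rewrite ler_pM2r.
have h4 : y v * (lam - p i) < (lam - p j) * y w * (lam - p i) by rewrite ltr_pM2r.
by move: h3 h4 h5 h6; move: (lam - p i) (lam - p j) => A B; lra.
Qed.

Lemma bistar_path S A : bistar (i + j).+1 S A -> uniq S -> double_pendant_path i j S.
Proof.
move=> [v [u [w [a [S1 [A1 [b [S2 [A2 [h1 h2 [vu vw] pS [_ /eq_add_S sumE]]]]]]]]]]] uS.
have uS' : uniq (v :: S1 ++ S2) by rewrite -(perm_uniq pS).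
have [ba|/ltnW ab] := leqP b a.
  have [ai bj P1 P2] := bistar_path_sorted (esym sumE) ba h1 h2 vu vw uS'.
  by subst a b; exists v, u, w, S1, S2.
have uS'' : uniq (v :: S2 ++ S1) by move: uS'; rewrite /= !mem_cat orbC uniq_catC.
have sumE' : (b + a = i + j)%N by rewrite addnC -sumE.
have [bi aj P1 P2] := bistar_path_sorted sumE' ab h2 h1 vw vu uS''.
subst a b; exists v, w, u, S2, S1; split=> //.
by apply: perm_trans pS _; rewrite perm_cons perm_catC.
Qed.

(** Summing over the two branches at [x] gives p a + p b.+1 <= lam, which [unbalanced_spider]
    excludes. *)
Lemma spider_child_lt a b x v l S1 A1 S2 A2 : (a + b.+1 = (i + j).+1)%N -> (0 < b)%N ->
  star x a S1 A1 -> star v b S2 A2 -> adj x v -> adj v l -> uniq (l :: S1 ++ S2) -> False.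
Proof.
move=> sumE b0 h1 h2 xv vl uS.
have [uS1 uS2] : uniq S1 /\ uniq S2 by move: uS; rewrite cons_uniq cat_uniq; case/and4P.
have xS1 := star_mem h1.
have sumx : nbr_sum y S1 x + y v <= lam * y x.
  apply: le_trans (nbr_sum_super y_gt0 y_super x uS); rewrite -cat1s !nbr_sum_cat.
  have := nbr_sum_ge0 y_gt0 [:: l] x.
  by have := @nbr_sum_mem _ _ _ y_gt0 S2 x v (star_mem h2) xv; lra.
have child := star_child y_gt0 lam_gt0 y_super xv vl uS xS1.
have yx := y_gt0 x; have yv := y_gt0 v.
have [|[posb ratb _]] := star_bound y_gt0 lam_gt0 y_super h2 uS2; first lra.
have yvx := star_child_ratio y_gt0 lam_gt0 y_super xv vl uS xS1 posb ratb.
rewrite -/mu -/p in posb ratb yvx child.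
(* The first alternative would give mu + p 1 <= lam, but p 1 = 1 / mu exceeds 1 / lam = lam - mu. *)
have [big|[posa rata _]] := star_bound y_gt0 lam_gt0 y_super h1 uS1.
  have : p 1 * y x <= p b.+1 * y x by rewrite ler_pM2r // cheb_ratio_le.
  have mu0 : 0 < mu by have := pos_i (isT : (1 <= i.+1)%N); rewrite chebSS cheb1 cheb0 mulr1 subr0.
  have : lam^-1 < p 1.
    rewrite /p /cheb_ratio chebSS cheb1 cheb0 mulr1 subr0 div1r ltf_pV2 //.
    by rewrite /mu gtrBl invr_gt0.
  by rewrite -(ltr_pM2r yx); move: big; rewrite mulrBl; lra.
rewrite -/mu -/p in posa rata.
have := unbalanced_spider lam_gt0 ji pos_i lam_gtp lam_eq sumE b0 (cheb_pos_le (leqnSn a) posa) posb.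
by rewrite -/mu -/p -(ltr_pM2r yx) mulrDl; lra.
Qed.

Lemma core_path S A : core S A -> uniq S -> size S = (i + j).+1.*2.+1 -> double_pendant_path i j S.
Proof.
move=> [k [[x h]|h]] uS szS; last first.
  apply: (bistar_path _ uS); suff <- : k = (i + j).+1 by exact: h.
  have [v [u [w [a [S1 [A1 [b [S2 [A2 [h1 h2 _ pS [_ ->]]]]]]]]]]] := h.
  move: szS; rewrite (perm_size pS) /= size_cat (star_size h1) (star_size h2).
  by clear; lia.
have {szS} kE : k = (i + j).+1 by move: szS; rewrite (star_size h); clear; lia.
case: h kE uS => [//|{}x a S1 A1 t b S2 A2 l T h1 h2 xt tl pT] kE uT.
have uS : uniq (l :: S1 ++ S2) by rewrite -(perm_uniq pT).
have sumE : (a + b.+1 = (i + j).+1)%N by rewrite addnS.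
have [b0|b0] := posnP b; last by case: (spider_child_lt sumE b0 h1 h2 xt tl uS).
(* The child [t] has no neighbor but [x] and its leaf [l], so it can play the
   role of the middle vertex, with [l] as a trivial second star. *)
subst b; apply: (@bistar_path _ (A1 ++ [:: l])) => //.
have S2E : S2 = [:: t].
  by move: (star_size h2) (star_mem h2); case: (S2) => [//|z [|//]] _; rewrite inE => /eqP->.
exists t, x, l, a, S1, A1, 0%N, [:: l], [:: l]; split=> //.
- exact: star1.
- by rewrite adj_sym.
- by apply: perm_trans pT _; rewrite S2E; clear; perm_count (perm_refl (Nil G)).
Qed.

End CoreIsPath.

(** * The Perron vector *)

(** Unitary diagonalization over the complex numbers writes the form as a sum of w_i |Z_i|^2 with
    w_i >= 0. If it vanishes, so does each w_i Z_i, and hence x (a - A). *)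
Lemma sym_rayleigh (R : rcfType) n (A : 'M[R]_n) (a : R) : A^T = A ->
  (forall b, eigenvalue A b -> b <= a) -> forall x : 'rV_n,
  let q := (x *m (a%:M - A) *m x^T) 0 0 in
  0 <= q /\ (q = 0 -> x *m A = a *: x).
Proof.
move=> symA maxA x; set f := real_complex R.
set M := a%:M - A => q; pose B := map_mx f A.
have hB : B \is hermsymmx.
  apply: realsym_hermsym.
    by apply/is_hermitianmxP; rewrite expr0 scale1r; apply/matrixP => i j; rewrite !mxE -{1}symA mxE.
  by apply/mxOverP => i j; rewrite mxE; apply/complex_realP; eexists.
have /mxOverP dreal := hermitian_spectral_diag_real hB.
have /hermitian_normalmx /orthomx_spectralP eB := hB.
set P := spectralmx B in eB; set d := spectral_diag B in eB dreal.
have uP : P \in unitmx by exact: spectral_unit.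
have d_le i : d 0 i <= f a.
  have /complex_realP [k hk] := dreal 0 i.
  have {}hk : d 0 i = f k := hk.
  rewrite hk lecR; apply: maxA; rewrite -(eigenvalue_map f); apply/eigenvalueP.
  exists (row i P).
    rewrite -row_mul [X in _ *m X]eB !mulmxA mulmxV // mul1mx.
    by apply/rowP => j; rewrite mul_diag_mx !mxE hk.
  apply/eqP => h0; have := mulmxV uP; move/(congr1 (row i)); rewrite row_mul h0 mul0mx => /rowP /(_ i).
  by rewrite !mxE eqxx => /esym/eqP; rewrite oner_eq0.
pose w := \row_i (f a - d 0 i).
have eM : map_mx f M = invmx P *m diag_mx w *m P.
  rewrite map_mxB map_scalar_mx -/B {1}eB.
  have -> : diag_mx w = (f a)%:M - diag_mx d.
    by apply/matrixP => i j; rewrite !mxE; case: eqP; rewrite ?mulr1n ?mulr0n ?subr0.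
  by rewrite mulmxBr mulmxBl mul_mx_scalar -scalemxAl mulVmx // scalemx1.
pose X := map_mx f x; pose Z := X *m invmx P.
have XM : X *m map_mx f M = Z *m diag_mx w *m P by rewrite eM !mulmxA.
have qE : f q = \sum_i w 0 i * (Z 0 i * (Z 0 i)^*).
  have -> : f q = (X *m map_mx f M *m X^T) 0 0.
    have -> : X^T = map_mx f x^T by apply/matrixP => i j; rewrite !mxE.
    by rewrite -!map_mxM mxE.
  rewrite XM -mulmxA.
  have -> : P *m X^T = \col_i (Z 0 i)^*.
    have PX : X = Z *m P by rewrite mulmxKV.
    have unitP : P \is unitarymx by exact: spectral_unitarymx.
    apply: (canLR (mulKVmx uP)); rewrite invmx_unitary //.
    apply/matrixP => i j; rewrite ord1 mxE.
    have -> : X 0 i = (X 0 i)^* by rewrite mxE; exact/esym/conjc_real.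
    rewrite PX !mxE rmorph_sum; apply: eq_bigr => k _.
    by rewrite !mxE rmorphM mulrC.
  rewrite mxE; apply: eq_bigr => i _; rewrite mul_mx_diag !mxE.
  by rewrite mulrAC mulrA mulrC mulrA.
have w_ge0 i : 0 <= w 0 i by rewrite mxE subr_ge0.
have term_ge0 i : 0 <= w 0 i * (Z 0 i * (Z 0 i)^*) by rewrite mulr_ge0 // mul_conjC_ge0.
split; first by rewrite -ler0c -/f qE sumr_ge0.
move=> q0; apply/eqP; rewrite eq_sym -subr_eq0 -mul_mx_scalar -mulmxBr -/M.
rewrite -(map_mx_eq0 f) map_mxM -/X XM.
suff -> : Z *m diag_mx w = 0 by rewrite mul0mx.
apply/rowP => i; rewrite mul_mx_diag [LHS]mxE [RHS]mxE.
have : w 0 i * (Z 0 i * (Z 0 i)^*) == 0.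
  move/eqP: qE; rewrite q0 (_ : f 0 = 0) // eq_sym psumr_eq0 // => /allP /(_ i).
  by rewrite mem_index_enum => /(_ isT).
by rewrite mulf_eq0 mul_conjC_eq0 => /orP[]/eqP->; rewrite ?mulr0 ?mul0r.
Qed.

Section Perron.
Variables (R : realType) (G : sgraph).
Hypothesis G_conn : connected G.

(** A zero at a vertex forces zeros at its neighbors, hence everywhere by connectedness. *)
Lemma nonneg_eigen_gt0 (y : G -> R) (a : R) : (forall v, 0 <= y v) -> (exists v, y v != 0) ->
  (forall v, \sum_(u | adj v u) y u = a * y v) -> forall v, 0 < y v.
Proof.
move=> y0 [z yz] eig v; rewrite lt_def y0 andbT; apply/negP => /eqP yv.
have zero_nbr u t : y u = 0 -> adj u t -> y t = 0.
  move=> yu ut; have /eqP := eig u; rewrite yu mulr0 psumr_eq0 // => /allP /(_ t).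
  by rewrite mem_index_enum ut /= => /(_ isT) /eqP.
have [p pth lst] := connectP (G_conn.2 v z); move: yz; rewrite lst => /eqP; apply.
elim: p {lst} v yv pth => //= t p IH v yv /andP[vt pth].
by apply: IH pth; exact: zero_nbr vt.
Qed.

(** Replacing a top eigenvector by its entrywise absolute value does not increase the form of
    [sym_rayleigh], so the form stays 0 and the absolute value is again an eigenvector. *)
Lemma perron : exists2 y : G -> R, (forall v, 0 < y v) &
  forall v, \sum_(u | adj v u) y u = spectral_radius R G * y v.
Proof.
have [G0 conn] := G_conn; set a := spectral_radius R G; set A := adjmx R G.
have [/eigenvalueP [x xA x0] maxA] := spectral_radius_max R G0.
rewrite -/A -/a in xA maxA.
have symA : A^T = A by apply/matrixP => i j; rewrite !mxE adj_sym.
have ray := sym_rayleigh symA maxA.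
have qE (z : 'rV_#|G|) : (z *m (a%:M - A) *m z^T) 0 0 =
    a * (\sum_i z 0 i ^+ 2) - \sum_i \sum_j z 0 i * A i j * z 0 j.
  rewrite mulmxBr mulmxBl mxE mul_mx_scalar -scalemxAl mxE; congr (_ * _ + _).
    by rewrite mxE; apply: eq_bigr => i _; rewrite mxE expr2.
  rewrite mxE exchange_big; congr (- _); rewrite mxE; apply: eq_bigr => j _ /=.
  by rewrite !mxE big_distrl.
pose z := map_mx Num.norm x.
have q0 : (z *m (a%:M - A) *m z^T) 0 0 = 0.
  apply/eqP; rewrite eq_le (ray z).1 andbT.
  have <- : (x *m (a%:M - A) *m x^T) 0 0 = 0.
    by rewrite mulmxBr xA mul_mx_scalar subrr mul0mx mxE.
  rewrite !qE; apply: lerB; last apply: ler_sum => i _; last apply: ler_sum => j _.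
    by rewrite (eq_bigr (fun i => x 0 i ^+ 2)) // => i _; rewrite mxE real_normK ?num_real.
  rewrite !mxE; apply: le_trans (ler_norm _) _; rewrite !normrM.
  by rewrite normr_nat.
have zA := (ray z).2 q0.
have eig v : \sum_(u | adj v u) z 0 (enum_rank u) = a * z 0 (enum_rank v).
  have /rowP /(_ (enum_rank v)) := zA; rewrite !mxE => <-.
  rewrite (reindex_onto enum_val enum_rank) => [|i _]; last by rewrite enum_rankK.
  under eq_bigl => i do rewrite enum_valK eqxx andbT.
  rewrite big_mkcond; apply: eq_bigr => i _; rewrite !mxE enum_rankK enum_valK adj_sym.
  by case: adj; rewrite ?mulr1 ?mulr0.
exists (fun v => z 0 (enum_rank v)) => //.
apply: nonneg_eigen_gt0 eig => [v|]; first by rewrite mxE.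
have /rV0Pn [i xi] := x0; exists (enum_val i).
by rewrite mxE enum_valK normr_eq0.
Qed.

(* Pairing with the Perron vector of [G]: [rho <y, z> = <A y, z> = <y, A z> <= lam <y, z>]. *)
Lemma supersolution_ge (z : G -> R) (lam : R) : (forall v, 0 < z v) ->
  (forall v, \sum_(u | adj v u) z u <= lam * z v) ->
  spectral_radius R G <= lam /\
  (spectral_radius R G = lam -> forall v, \sum_(u | adj v u) z u = lam * z v).
Proof.
move=> z0 super; have [y y0 eig] := perron; set a := spectral_radius R G in eig *.
have [/card_gt0P[r _] _] := G_conn.
have pair : \sum_v y v * (lam * z v - \sum_(u | adj v u) z u) = (lam - a) * \sum_v y v * z v.
  rewrite mulrBl !mulr_sumr -sumrB.
  under eq_bigr => v _ do rewrite mulrBr.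
  rewrite !sumrB; congr (_ - _); first by apply: eq_bigr => v _; ring.
  under eq_bigr => v _ do rewrite mulr_sumr big_mkcond /=.
  rewrite exchange_big /=; apply: eq_bigr => u _.
  rewrite mulrA -eig mulr_suml [RHS]big_mkcond /=; apply: eq_bigr => v _.
  by rewrite adj_sym.
have yz0 : 0 < \sum_v y v * z v.
  rewrite (bigD1 r) //= ltr_pwDl ?mulr_gt0 // sumr_ge0 // => v _.
  by rewrite mulr_ge0 // ltW.
have term0 v : 0 <= y v * (lam * z v - \sum_(u | adj v u) z u).
  by rewrite mulr_ge0 ?subr_ge0 // ltW.
split; first by rewrite -subr_ge0 -(pmulr_lge0 _ yz0) -pair sumr_ge0.
move=> alam v; move/eqP: pair; rewrite alam subrr mul0r psumr_eq0 // => /allP /(_ v).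
rewrite mem_index_enum => /(_ isT); rewrite mulf_eq0 gt_eqF //= subr_eq0.
by move/eqP.
Qed.

End Perron.

(** * The extremal tree and the theorem *)

Lemma cheb_recurrence (R : realFieldType) (mu : R) (A : nat -> R) n : A 0 = 0 ->
  (forall k, (k < n)%N -> A k.+2 = mu * A k.+1 - A k) ->
  forall k, (k <= n.+1)%N -> A k = cheb mu k * A 1.
Proof.
move=> A0 rec; elim/ltn_ind => -[|[|k]] IH kn.
- by rewrite A0 cheb0 mul0r.
- by rewrite cheb1 mul1r.
- by rewrite rec // chebSS mulrBl -mulrA -!IH //; lia.
Qed.

Section ZeroExtension.
Variables (R : numDomainType) (n : nat) (f : 'I_n -> R).

(** Extension by zero makes the eigenvalue equations uniform at the path ends and at vertices
    without a leaf. *)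
Definition ext0 (k : nat) : R := oapp f 0 (insub k).

Lemma ext0_ord (k : 'I_n) : ext0 k = f k.
Proof. by rewrite /ext0 valK. Qed.

Lemma ext0_out k : (n <= k)%N -> ext0 k = 0.
Proof. by move=> nk; rewrite /ext0 insubF // ltnNge nk. Qed.

Lemma sum_ord_eq k : \sum_(l < n | l == k :> nat) f l = ext0 k.
Proof.
under eq_bigr => l _ do rewrite -ext0_ord.
by rewrite big_ord1_eq; case: ltnP => // /ext0_out->.
Qed.

End ZeroExtension.

(** * Eigenvalue equations of the extremal tree *)

Section TtreeEigenvector.
Variables (R : realFieldType) (i j : nat).
Let m := (i + j).+3.
Let T := Ttree m i j.
Variables (z : T -> R) (lam : R).
Hypothesis z_gt0 : forall x, 0 < z x.
Hypothesis z_eig : forall x, \sum_(u | adj x u) z u = lam * z x.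

Let mu := lam - lam^-1.
Let W := ext0 (fun k : 'I_m => z (inl k)).
Let Lf := ext0 (fun a : 'I_i => z (inr (inl a))).
Let Rt := ext0 (fun b : 'I_j => z (inr (inr b))).

Let sum_T (P : pred T) : \sum_(u | P u) z u =
  \sum_(k < m | P (inl k)) z (inl k) +
  (\sum_(a < i | P (inr (inl a))) z (inr (inl a)) + \sum_(b < j | P (inr (inr b))) z (inr (inr b))).
Proof. by rewrite big_sumType big_sumType. Qed.

Let W_gt0 k : (k < m)%N -> 0 < W k.
Proof. by move=> km; rewrite /W -[k]/(val (Ordinal km)) ext0_ord. Qed.

Let left_leaf a : (a < i)%N -> lam * Lf a = W a.
Proof.
move=> ai; rewrite /Lf -[a]/(val (Ordinal ai)) ext0_ord -z_eig sum_T /=.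
by rewrite [X in _ + (X + _)]big_pred0 // [X in _ + (_ + X)]big_pred0 // ?addr0 /W /Lf /Rt -sum_ord_eq; apply: eq_bigl => k; rewrite /pend_adj /=.
Qed.

Let right_leaf b : (b < j)%N -> lam * Rt b = W (i.+3 + b)%N.
Proof.
move=> bj; rewrite /Rt -[b]/(val (Ordinal bj)) ext0_ord -z_eig sum_T /=.
rewrite [X in _ + (X + _)]big_pred0 // [X in _ + (_ + X)]big_pred0 // ?addr0 /W /Lf /Rt -sum_ord_eq; apply: eq_bigl => k.
by rewrite /pend_adj /= /m; lia.
Qed.

(** The right pendants start at position m - j = i + 3; the guard keeps truncated subtraction from
    reading [Rt 0] at earlier positions. *)
Let path_vertex k : (k < m)%N -> lam * W k =
  (if k is k'.+1 then W k' else 0) + W k.+1 + Lf k +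
  (if (i.+3 <= k)%N then Rt (k - i.+3)%N else 0).
Proof.
move=> km; rewrite {1}/W -[k in LHS]/(val (Ordinal km)) ext0_ord -z_eig sum_T /= -addrA.
congr (_ + (_ + _)).
- rewrite (eq_bigl (fun l : 'I_m => (l == k.+1 :> nat) || (l.+1 == k))); last first.
    by move=> l; rewrite /pend_adj /= eq_sym.
  rewrite (bigID (fun l : 'I_m => l == k.+1 :> nat)) /= addrC; congr (_ + _); last first.
    by rewrite /W /Lf /Rt -sum_ord_eq; apply: eq_bigl => l; lia.
  case: (k) => [|k']; first by apply: big_pred0 => l; lia.
  by rewrite /W /Lf /Rt -sum_ord_eq; apply: eq_bigl => l; lia.
- rewrite /W /Lf /Rt -sum_ord_eq; apply: eq_bigl => a.
  by rewrite /pend_adj /= orbF eq_sym.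
- case: ifPn => ik.
    rewrite /W /Lf /Rt -sum_ord_eq; apply: eq_bigl => b.
    by rewrite /pend_adj /= /m; lia.
  apply: big_pred0 => b; rewrite /pend_adj /= /m; lia.
Qed.

Lemma Ttree_lam_gt0 : 0 < lam.
Proof.
have im : (i.+1 < m)%N by rewrite /m; lia.
have := path_vertex im; rewrite ifN ?addr0 => [eq_v|]; last by lia.
have Lf0 : Lf i.+1 = 0 by rewrite /Lf ext0_out.
rewrite Lf0 addr0 in eq_v.
rewrite -(pmulr_lgt0 _ (W_gt0 im)) eq_v addr_gt0 //; apply: W_gt0; rewrite /m; lia.
Qed.

Let lam_neq0 : lam != 0. Proof. exact: lt0r_neq0 Ttree_lam_gt0. Qed.

(* The eigenvector along the path, read from either end and shifted by one so
   that it vanishes at 0. *)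
Let A k := if k is k'.+1 then W k' else 0.
Let B k := if k is k'.+1 then W (m - k)%N else 0.

(** Eliminating the leaf at each arm vertex leaves the Chebyshev recurrence at [mu]. *)
Let A_cheb k : (k <= i.+1)%N -> A k = cheb mu k * W 0.
Proof.
apply: cheb_recurrence => // {}k ki.
have km : (k < m)%N by rewrite /m; lia.
have := path_vertex km; rewrite ifN ?addr0; last by lia.
rewrite -/(A k) => eqk.
have := left_leaf ki => eql; have LfE : Lf k = W k / lam by rewrite -eql mulrC mulKf.
rewrite (erefl : A k.+2 = W k.+1) (erefl : A k.+1 = W k) /mu mulrBl [lam^-1 * _]mulrC -LfE.
by rewrite eqk; ring.
Qed.

Let B_cheb k : (k <= j.+1)%N -> B k = cheb mu k * W m.-1.
Proof.
rewrite -[W m.-1]/(B 1); apply: cheb_recurrence => // {}k kj.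
have km : (m - k.+1 < m)%N by rewrite /m; lia.
have := path_vertex km; rewrite ifT; last by rewrite /m; lia.
rewrite {2}(_ : (m - k.+1 = (m - k.+2).+1)%N); last by rewrite /m; lia.
have -> : Lf (m - k.+1)%N = 0 by rewrite /Lf ext0_out // /m; lia.
have -> : W (m - k.+1).+1 = B k.
  case: k kj {km} => [|k] kj; first by rewrite /W ext0_out // /m; lia.
  by rewrite (erefl : B k.+1 = W (m - k.+1)%N); congr (W _); rewrite /m; lia.
have kj' : (m - k.+1 - i.+3 < j)%N by rewrite /m; lia.
have idx : (i.+3 + (m - k.+1 - i.+3) = m - k.+1)%N by rewrite /m; lia.
have eql := right_leaf kj'; rewrite idx in eql.
have RtE : Rt (m - k.+1 - i.+3)%N = W (m - k.+1)%N / lam by rewrite -eql mulrC mulKf.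
rewrite RtE (erefl : B k.+2 = W (m - k.+2)%N) (erefl : B k.+1 = W (m - k.+1)%N) /mu mulrBl [lam^-1 * _]mulrC.
lra.
Qed.

(** With each arm summed up by [p], the equations at the three path vertices without pendants are
    [eqU], [eqV] and [eqX]; eliminating the vertex values gives the last identity. *)
Lemma Ttree_charpoly : let p := cheb_ratio mu in
  [/\ cheb_pos mu i.+1, 0 < lam - p i /\ 0 < lam - p j &
      lam * (lam - p i) * (lam - p j) = (lam - p i) + (lam - p j)].
Proof.
move=> p; have lam0 := Ttree_lam_gt0.
have mE : m = (i + j).+3 by [].
have W0 : 0 < W 0 by exact: W_gt0.
have Wm : 0 < W m.-1 by apply: W_gt0.
have U0 : 0 < W i by apply: W_gt0; lia.
have V0 : 0 < W i.+1 by apply: W_gt0; lia.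
have X0 : 0 < W i.+2 by apply: W_gt0; lia.
have pos_i : cheb_pos mu i.
  move=> k ki; rewrite -(pmulr_lgt0 _ W0) -A_cheb //; apply: W_gt0; lia.
have pos_j : 0 < cheb mu j.+1.
  by rewrite -(pmulr_lgt0 _ Wm) -B_cheb //; apply: W_gt0; lia.
have BX : B j.+1 = W i.+2 by rewrite (erefl : B j.+1 = W (m - j.+1)%N); congr (W _); lia.
have piE : p i * W i = A i.
  rewrite /p /cheb_ratio -[W i]/(A i.+1) !A_cheb // mulrA divfK // lt0r_neq0 //; exact: pos_i.
have pjE : p j * W i.+2 = B j.
  by rewrite /p /cheb_ratio -BX !B_cheb // mulrA divfK // lt0r_neq0.
have eqU : (lam - p i) * W i = W i.+1.
  rewrite mulrBl piE path_vertex; last lia.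
  rewrite ifN; last lia.
  by rewrite /Lf ext0_out // !addr0 addrC addKr.
have eqV : lam * W i.+1 = W i + W i.+2.
  rewrite path_vertex; last lia.
  rewrite ifN; last lia.
  by rewrite /Lf ext0_out // !addr0.
have eqX : (lam - p j) * W i.+2 = W i.+1.
  rewrite mulrBl pjE path_vertex; last lia.
  rewrite ifN; last lia.
  rewrite /Lf ext0_out ?addr0; last lia.
  suff -> : W i.+3 = B j by rewrite addrK.
  case: (posnP j) => [j0|j_gt0]; first by rewrite j0 /W ext0_out //; lia.
  by rewrite -(prednK j_gt0) (erefl : B j.-1.+1 = W (m - j.-1.+1)%N); congr (W _); lia.
have al0 : 0 < lam - p i by rewrite -(pmulr_lgt0 _ U0) eqU.
have be0 : 0 < lam - p j by rewrite -(pmulr_lgt0 _ X0) eqX.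
have lam_eq : lam * (lam - p i) * (lam - p j) = (lam - p i) + (lam - p j).
  apply: (mulIf (lt0r_neq0 V0)).
  transitivity ((lam - p j) * ((lam - p i) * W i) + (lam - p i) * ((lam - p j) * W i.+2)).
    have -> : lam * (lam - p i) * (lam - p j) * W i.+1 =
      (lam - p i) * (lam - p j) * (lam * W i.+1) by ring.
    by rewrite eqV; ring.
  by rewrite eqU eqX; ring.
(* By [lam_eq], lam (lam - p i) - 1 = (lam - p i) / (lam - p j), so mu - p i is positive and one
   more Chebyshev value is positive. *)
split=> //; apply: cheb_posS => //.
have := sub_cheb_ratio (pos_i i (leqnn i)).
have : 0 < mu - p i.
  have h : lam * (lam - p i) = (lam - p i) / (lam - p j) + 1.
    by apply: (mulIf (lt0r_neq0 be0)); rewrite lam_eq; field; rewrite lt0r_neq0.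
  have -> : mu - p i = (lam * (lam - p i) - 1) / lam by rewrite /mu; field.
  by rewrite h addrK !divr_gt0.
rewrite -/p => h1 h2; move: h1; rewrite h2 pmulr_lgt0 // invr_gt0; exact: pos_i.
Qed.

End TtreeEigenvector.

(** * Comparison of spectral radii and conclusion *)

Lemma graph_iso_sym (G H : sgraph) : graph_iso G H -> graph_iso H G.
Proof.
move=> [f [g fK gK] fE]; exists g; first by exists f.
by move=> x y; rewrite -fE !gK.
Qed.

Lemma iso_spectral_radius_le (R : realType) (G H : sgraph) :
  connected G -> connected H -> graph_iso G H -> spectral_radius R G <= spectral_radius R H.
Proof.
move=> G_conn H_conn [f f_bij fE]; have [y y0 eig] := perron R H_conn.
apply: (supersolution_ge G_conn (z := y \o f) _ _).1 => [v|v] /=; first exact: y0.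
rewrite -eig [leRHS](reindex f) /=; last exact: onW_bij.
by under [leRHS]eq_bigl => u do rewrite fE.
Qed.

Lemma iso_spectral_radius (R : realType) (G H : sgraph) : connected G -> connected H ->
  graph_iso G H -> spectral_radius R G = spectral_radius R H.
Proof.
move=> G_conn H_conn iso; apply/le_anti/andP.
by split; apply: iso_spectral_radius_le => //; exact: graph_iso_sym.
Qed.

(** Pulled back along [f], the Perron vector of [G] is a supersolution on [H], hence exact by
    [supersolution_ge]. An extra edge of [G] would make the inequality strict at its ends. *)
Lemma spanning_hom_iso (R : realType) (G H : sgraph) (f : H -> G) :
  connected G -> connected H -> bijective f ->
  (forall a b, adj a b -> adj (f a) (f b)) ->
  spectral_radius R G <= spectral_radius R H -> graph_iso G H.
Proof.
move=> G_conn H_conn f_bij hom le_rho; apply: graph_iso_sym; exists f => // a b.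
apply/idP/idP; last exact: hom.
have [y y0 eig] := perron R G_conn; move=> fab; apply/negPn/negP => nab.
have nbrG c : \sum_(u | adj c u) y (f u) <= \sum_(u | adj (f c) (f u)) y (f u).
  rewrite [leRHS](bigID (adj c)) /=.
  rewrite (eq_bigl (fun u => adj (f c) (f u) && adj c u)) => [|u]; last first.
    by case cu: (adj c u); rewrite ?andbF // (hom _ _ cu).
  by rewrite lerDl sumr_ge0 // => u _; exact/ltW.
have eigf c : \sum_(u | adj (f c) (f u)) y (f u) = spectral_radius R G * y (f c).
  by rewrite -eig [RHS](reindex f) //; exact: onW_bij.
have super c : \sum_(u | adj c u) (y \o f) u <= spectral_radius R H * (y \o f) c.
  by apply: le_trans (nbrG c) _; rewrite eigf ler_pM2r.
have [_ exact_sup] := supersolution_ge H_conn (fun c => y0 (f c)) super.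
have := exact_sup erefl a; rewrite /= => eq_a.
have : spectral_radius R G * y (f a) <= spectral_radius R H * y (f a) by rewrite ler_pM2r.
rewrite -eq_a -eigf leNgt => /negP; apply.
rewrite [ltRHS](bigID (adj a)) /= (eq_bigl (fun u => adj (f a) (f u) && adj a u)) => [|u]; last first.
  by case au: (adj a u); rewrite ?andbF // (hom _ _ au).
rewrite ltrDl (bigD1 b) /=; last by rewrite fab nab.
by rewrite ltr_pwDl // sumr_ge0 // => u _; exact/ltW.
Qed.

Lemma spectral_radius_le_iso (R : realType) (G : sgraph) (i j : nat) :
  (j <= i <= j.+1)%N -> connected G -> #|G| = (i + j).+1.*2.+1 ->
  domination_number G = (i + j).+1 ->
  let T := Ttree (i + j).+3 i j in
  spectral_radius R G <= spectral_radius R T -> graph_iso G T.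
Proof.
move=> ji G_conn G_order G_dom T le_rho.
have T_conn : connected T := Ttree_connected i j.
have [S pG [A hA]] := core_of_domination_number G_conn (ltn0Sn _) G_order G_dom.
have [z z0 z_eig] := perron R T_conn.
have lam0 := Ttree_lam_gt0 z0 z_eig.
have [pos_i lam_p lam_eq] := Ttree_charpoly z0 z_eig.
have [y y0 y_eig] := perron R G_conn.
have super v : \sum_(u | adj v u) y u <= spectral_radius R T * y v.
  by rewrite y_eig ler_pM2r.
have uS : uniq S by rewrite (perm_uniq pG) enum_uniq.
have szS : size S = (i + j).+1.*2.+1 by rewrite (perm_size pG) -cardE.
have dpp := core_path y0 lam0 super ji pos_i lam_p lam_eq hA uS szS.
have [f f_bij hom] := double_pendant_path_hom dpp pG.
exact: spanning_hom_iso hom le_rho.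
Qed.

Theorem theorem1p3 (R : realType) (n : nat) (hn : (3 <= n)%N) (n_odd : odd n)
    (G : sgraph) (G_order : #|G| = n) (G_conn : connected G)
    (G_dom : domination_number G = (n %/ 2)%N) :
  let T := Ttree ((n + 3) %/ 2) (ceildivn (n - 3) 4) ((n - 3) %/ 4) in
  (spectral_radius R T <= spectral_radius R G)%R /\
  (spectral_radius R G = spectral_radius R T <-> graph_iso G T).
Proof.
move=> T; pose i := ceildivn (n - 3) 4; pose j := ((n - 3) %/ 4)%N.
(* [i] and [j] are the two halves of (n - 3) / 2, rounded up and down. *)
have nE : n = (i + j).+1.*2.+1.
  by rewrite -[LHS]odd_double_half n_odd /i /j /ceildivn; lia.
have ji : (j <= i <= j.+1)%N by rewrite /i /j /ceildivn; lia.
have TE : T = Ttree (i + j).+3 i j by rewrite /T; congr Ttree; lia.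
have T_conn : connected T by rewrite TE; exact: Ttree_connected.
have iso_of_le : spectral_radius R G <= spectral_radius R T -> graph_iso G T.
  rewrite TE; apply: spectral_radius_le_iso => //; first by rewrite G_order.
  by rewrite G_dom {1}nE; lia.
have eq_of_iso := iso_spectral_radius R G_conn T_conn.
split; last by split=> [eq_rho|/eq_of_iso//]; apply: iso_of_le; rewrite eq_rho.
have [/iso_of_le/eq_of_iso->//|/ltW//] := leP (spectral_radius R G) (spectral_radius R T).
Qed.
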